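(* The eventual dominance relation $<^*$ on $\omega^\omega$ has the total universality property.
   Context: For $x,y\in\omega^\omega$, $x<^*y$ means $x(n)<y(n)$ for all but finitely many $n$. A model is a transitive set or class satisfying a fixed sufficiently large finite fragment of $\mathsf{ZF}+\mathsf{DC}$ including Powerset (e.g. restricted to $\Sigma_{2026}$-formulas). For a model $M$, $d\in\omega^\omega$ is $<^*$-dominating over $M$ if $x<^*d$ for all $x\in\omega^\omega\cap M$. The relation $<^*$ has the total universality property if for every countable model $M$ and every $d\in\omega^\omega$ that is $<^*$-dominating over $M$, $d$ is universally $<^*$-dominating over $M$: for every forcing notion $\mathbb{Q}\in M$ there is a $\mathbb{Q}$-generic filter $G$ over $M$ such that $d$ is $<^*$-dominating over $M[G]$. *)

(* Defs.v *)
From Stdlib Require Import List Arith Lia.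

Set Implicit Arguments.
Unset Strict Implicit.

(** * The universe of sets: well-founded trees up to bisimulation *)

Inductive V : Type := sup : forall A : Type, (A -> V) -> V.

Definition idx (x : V) : Type := match x with @sup A _ => A end.
Definition elt (x : V) : idx x -> V := match x with sup f => f end.

(** Equality of the represented sets; Leibniz equality on [V] is never used. *)
Fixpoint eqV (x y : V) : Prop :=
  match x, y with
  | sup f, sup g =>
      (forall a, exists b, eqV (f a) (g b)) /\
      (forall b, exists a, eqV (f a) (g b))
  end.

Definition inV (x y : V) : Prop := exists b : idx y, eqV x (elt b).

Definition subV (x y : V) : Prop := forall z, inV z x -> inV z y.

Definition emptyV : V := @sup Empty_set (fun e => match e with end).
Definition upair (x y : V) : V := @sup bool (fun b => if b then x else y).
Definition opair (x y : V) : V := upair (upair x x) (upair x y).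
Definition succV (x : V) : V :=
  @sup (option (idx x)) (fun o => match o with Some a => elt a | None => x end).

Fixpoint numV (n : nat) : V :=
  match n with 0 => emptyV | S n => succV (numV n) end.

(** The element of the Baire space as a set of ordered pairs. *)
Definition realV (x : nat -> nat) : V :=
  @sup nat (fun n => opair (numV n) (numV (x n))).

Definition transitiveV (M : V) : Prop :=
  forall x y, inV x y -> inV y M -> inV x M.

Definition countableV (M : V) : Prop :=
  exists e : nat -> V, forall x, inV x M -> exists n, eqV x (e n).

Lemma eqV_refl x : eqV x x.
Proof. induction x as [A f IH]; simpl; split; intro a; exists a; apply IH. Qed.

Lemma eqV_sym x y : eqV x y -> eqV y x.
Proof.
  revert y; induction x as [A f IH]; intros [B g]; simpl; intros [H1 H2]; split.
  - intro b; destruct (H2 b) as [a Ha]; exists a; auto.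
  - intro a; destruct (H1 a) as [b Hb]; exists b; auto.
Qed.

Lemma eqV_trans x y z : eqV x y -> eqV y z -> eqV x z.
Proof.
  revert y z; induction x as [A f IH]; intros [B g] [C h]; simpl.
  intros [H1 H2] [H3 H4]; split.
  - intro a; destruct (H1 a) as [b Hb]; destruct (H3 b) as [c Hc]; exists c; eauto.
  - intro c; destruct (H4 c) as [b Hb]; destruct (H2 b) as [a Ha]; exists a; eauto.
Qed.

Lemma inV_eq x x' y y' : eqV x x' -> eqV y y' -> inV x y -> inV x' y'.
Proof.
  intros Hx Hy [b Hb]; destruct y as [B g], y' as [C h]; simpl in *.
  destruct Hy as [Hy _]; destruct (Hy b) as [c Hc].
  exists c; simpl; eauto using eqV_trans, eqV_sym.
Qed.

Lemma eqV_ext x y : eqV x y <-> (forall z, inV z x <-> inV z y).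
Proof.
  split.
  - intros H z; split; apply inV_eq; auto using eqV_refl, eqV_sym.
  - destruct x as [A f], y as [B g]; intros H; split.
    + intro a; apply (proj1 (H (f a))); exists a; apply eqV_refl.
    + intro b; destruct (proj2 (H (g b))) as [a Ha].
      * exists b; apply eqV_refl.
      * exists a; apply eqV_sym, Ha.
Qed.

Lemma inV_upair z x y : inV z (upair x y) <-> eqV z x \/ eqV z y.
Proof.
  split.
  - intros [[|] H]; auto.
  - intros [H|H]; [exists true | exists false]; exact H.
Qed.

Lemma inV_elt x (a : idx x) : inV (elt a) x.
Proof. exists a; apply eqV_refl. Qed.

Lemma upair_eq x x' y y' : eqV x x' -> eqV y y' -> eqV (upair x y) (upair x' y').
Proof.
  intros Hx Hy; split; intros [|]; [exists true|exists false|exists true|exists false]; auto.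
Qed.

Lemma opair_eq x x' y y' : eqV x x' -> eqV y y' -> eqV (opair x y) (opair x' y').
Proof. intros Hx Hy; apply upair_eq; apply upair_eq; auto. Qed.

Lemma upair_inj x y x' y' :
  eqV (upair x y) (upair x' y') ->
  eqV x x' /\ eqV y y' \/ eqV x y' /\ eqV y x'.
Proof.
  intros [H1 H2].
  destruct (H1 true) as [[|] A1], (H1 false) as [[|] A2],
    (H2 true) as [[|] B1], (H2 false) as [[|] B2]; simpl in *;
    eauto 8 using eqV_trans, eqV_sym.
Qed.

Lemma opair_inj x y x' y' :
  eqV (opair x y) (opair x' y') <-> eqV x x' /\ eqV y y'.
Proof.
  split; [|intros [H1 H2]; apply opair_eq; auto].
  intros H; apply upair_inj in H; destruct H as [[H1 H2]|[H1 H2]];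
    apply upair_inj in H1; apply upair_inj in H2;
    intuition eauto 6 using eqV_trans, eqV_sym.
Qed.

(** * First-order formulas of set theory *)

(** Variables are named by natural numbers. *)
Inductive form : Type :=
| fMem (i j : nat)
| fEq (i j : nat)
| fNot (A : form)
| fAnd (A B : form)
| fOr (A B : form)
| fImp (A B : form)
| fIff (A B : form)
| fAll (i : nat) (A : form)
| fEx (i : nat) (A : form).

Declare Scope form_scope.
Delimit Scope form_scope with form.
Bind Scope form_scope with form.
Notation "i ∈ j" := (fMem i%nat j%nat) (at level 70) : form_scope.
Notation "i ≐ j" := (fEq i%nat j%nat) (at level 70) : form_scope.
Notation "¬ A" := (fNot A) (at level 75, right associativity) : form_scope.
Notation "A ∧ B" := (fAnd A B) (at level 80, right associativity) : form_scope.
Notation "A ∨ B" := (fOr A B) (at level 85, right associativity) : form_scope.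
Notation "A ⇒ B" := (fImp A B) (at level 99, right associativity) : form_scope.
Notation "A ⇔ B" := (fIff A B) (at level 95, no associativity) : form_scope.
Notation "∀ i , A" := (fAll i%nat A) (at level 200, i at level 60) : form_scope.
Notation "∃ i , A" := (fEx i%nat A) (at level 200, i at level 60) : form_scope.

Fixpoint free (v : nat) (A : form) : Prop :=
  match A with
  | fMem i j | fEq i j => v = i \/ v = j
  | fNot A => free v A
  | fAnd A B | fOr A B | fImp A B | fIff A B => free v A \/ free v B
  | fAll i A | fEx i A => v <> i /\ free v A
  end.

Definition upd (e : nat -> V) (i : nat) (x : V) : nat -> V :=
  fun j => if Nat.eqb j i then x else e j.

(** Truth in the structure [(M, ∈)] under the assignment [e]. *)
Fixpoint sat (M : V) (e : nat -> V) (A : form) : Prop :=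
  match A with
  | fMem i j => inV (e i) (e j)
  | fEq i j => eqV (e i) (e j)
  | fNot A => ~ sat M e A
  | fAnd A B => sat M e A /\ sat M e B
  | fOr A B => sat M e A \/ sat M e B
  | fImp A B => sat M e A -> sat M e B
  | fIff A B => sat M e A <-> sat M e B
  | fAll i A => forall x, inV x M -> sat M (upd e i x) A
  | fEx i A => exists x, inV x M /\ sat M (upd e i x) A
  end.

(** Truth of the universal closure. *)
Definition satisfies (M : V) (A : form) : Prop :=
  forall e : nat -> V, (forall i, inV (e i) M) -> sat M e A.

(** * The axioms of ZF + DC *)

(** In the abbreviations with a first argument [k], the bound variables are
    [k, k+1, ...]; to avoid capture, the other arguments must be below [k]. *)
Definition is_empty (k x : nat) : form := (∀ k, ¬ k ∈ x)%form.
Definition is_succ (k s n : nat) : form := (∀ k, k ∈ s ⇔ k ∈ n ∨ k ≐ n)%form.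
Definition is_upair (k z x y : nat) : form := (∀ k, k ∈ z ⇔ k ≐ x ∨ k ≐ y)%form.
Definition is_opair (k p x y : nat) : form :=
  (∀ k, k ∈ p ⇔ is_upair (k+1) k x x ∨ is_upair (k+1) k x y)%form.
Definition opair_in (k x y r : nat) : form :=
  (∃ k, k ∈ r ∧ is_opair (k+1) k x y)%form.
Definition is_inductive (k u : nat) : form :=
  ((∃ k, k ∈ u ∧ is_empty (k+1) k) ∧
   (∀ k, k ∈ u ⇒ ∃ (k+1), (k+1) ∈ u ∧ is_succ (k+2) (k+1) k))%form.
Definition is_omega (k w : nat) : form :=
  (∀ k, k ∈ w ⇔ (∀ (k+1), is_inductive (k+2) (k+1) ⇒ k ∈ (k+1)))%form.
Definition is_function (k f a b : nat) : form :=
  ((∀ k, k ∈ f ⇒ ∃ (k+1), ∃ (k+2),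
      (k+1) ∈ a ∧ (k+2) ∈ b ∧ is_opair (k+3) k (k+1) (k+2)) ∧
   (∀ k, k ∈ a ⇒ ∃ (k+1), ∀ (k+2),
      opair_in (k+3) k (k+2) f ⇔ (k+2) ≐ (k+1)))%form.

Definition Extensionality : form :=
  (∀ 0, ∀ 1, (∀ 2, 2 ∈ 0 ⇔ 2 ∈ 1) ⇒ 0 ≐ 1)%form.
Definition Foundation : form :=
  (∀ 0, (∃ 1, 1 ∈ 0) ⇒ ∃ 1, 1 ∈ 0 ∧ ¬ (∃ 2, 2 ∈ 1 ∧ 2 ∈ 0))%form.
Definition Pairing : form :=
  (∀ 0, ∀ 1, ∃ 2, is_upair 3 2 0 1)%form.
Definition Union : form :=
  (∀ 0, ∃ 1, ∀ 2, 2 ∈ 1 ⇔ (∃ 3, 3 ∈ 0 ∧ 2 ∈ 3))%form.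
Definition Powerset : form :=
  (∀ 0, ∃ 1, ∀ 2, 2 ∈ 1 ⇔ (∀ 3, 3 ∈ 2 ⇒ 3 ∈ 0))%form.
Definition Infinity : form :=
  (∃ 0, is_inductive 1 0)%form.

(** For [A(0)] with parameters; [2] must not be free in [A]. *)
Definition Separation (A : form) : form :=
  (∀ 1, ∃ 2, ∀ 0, 0 ∈ 2 ⇔ 0 ∈ 1 ∧ A)%form.

(** For [A(0,1)] with parameters; [3] and [4] must not be free in [A]. *)
Definition Replacement (A : form) : form :=
  (∀ 2, (∀ 0, 0 ∈ 2 ⇒ ∃ 4, ∀ 1, A ⇔ 1 ≐ 4) ⇒
        ∃ 3, ∀ 1, 1 ∈ 3 ⇔ (∃ 0, 0 ∈ 2 ∧ A))%form.

(** [0] is the underlying set, [1] the relation, [2] is omega and [3] the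
    sequence. *)
Definition DependentChoice : form :=
  (∀ 0, ∀ 1,
     (∃ 2, 2 ∈ 0) ∧
     (∀ 2, 2 ∈ 0 ⇒ ∃ 3, 3 ∈ 0 ∧ opair_in 4 2 3 1) ⇒
     ∃ 2, is_omega 3 2 ∧
     ∃ 3, is_function 4 3 2 0 ∧
     (∀ 4, 4 ∈ 2 ⇒ ∃ 5, ∃ 6, ∃ 7,
        is_succ 8 5 4 ∧ opair_in 8 4 6 3 ∧ opair_in 8 5 7 3 ∧
        opair_in 8 6 7 1))%form.

Inductive ZFDC : form -> Prop :=
| ax_extensionality : ZFDC Extensionality
| ax_foundation : ZFDC Foundation
| ax_pairing : ZFDC Pairing
| ax_union : ZFDC Union
| ax_powerset : ZFDC Powerset
| ax_infinity : ZFDC Infinity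
| ax_separation A : ~ free 2 A -> ZFDC (Separation A)
| ax_replacement A : ~ free 3 A -> ~ free 4 A -> ZFDC (Replacement A)
| ax_dependent_choice : ZFDC DependentChoice.

Definition finite_fragment (T : list form) : Prop :=
  (forall A, In A T -> ZFDC A) /\ In Powerset T.

(** Set models only: a countable model is a set. *)
Definition set_model (T : list form) (M : V) : Prop :=
  (exists x, inV x M) /\ transitiveV M /\ (forall A, In A T -> satisfies M A).

(** * Forcing *)

(** A forcing notion is a nonempty preorder [opair P r]; [opair p q] in [r]
    means that [p] is stronger than [q].  No largest element is required. *)
Definition leV (r p q : V) : Prop := inV (opair p q) r.

Definition forcing_notion (P r : V) : Prop :=
  (exists p, inV p P) /\
  (forall x, inV x r ->
     exists p q, inV p P /\ inV q P /\ eqV x (opair p q)) /\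
  (forall p, inV p P -> leV r p p) /\
  (forall p q s, leV r p q -> leV r q s -> leV r p s).

Definition dense (P r D : V) : Prop :=
  subV D P /\ forall p, inV p P -> exists q, inV q D /\ leV r q p.

Definition filter (P r G : V) : Prop :=
  subV G P /\
  (exists p, inV p G) /\
  (forall p q, inV p G -> inV q P -> leV r p q -> inV q G) /\
  (forall p q, inV p G -> inV q G ->
     exists s, inV s G /\ leV r s p /\ leV r s q).

Definition generic (M P r G : V) : Prop :=
  filter P r G /\
  forall D, inV D M -> dense P r D -> exists p, inV p G /\ inV p D.

Inductive is_name (P : V) : V -> Prop :=
| is_name_intro t :
    (forall x, inV x t -> exists s p, inV p P /\ eqV x (opair s p)) ->
    (forall s p, inV (opair s p) t -> is_name P s) ->
    is_name P t.

(** [val G t = {val G s : (s, p) ∈ t for some p ∈ G}].  For a structural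
    recursion, [s] is picked among the elements of elements of members of [t]:
    [s ∈ {s} ∈ (s, p) ∈ t].  See [inV_val]. *)
Fixpoint val (G t : V) : V :=
  match t with
  | sup f =>
      @sup
        {a : _ & {b : idx (f a) &
           {c : idx (elt b) |
              exists p, inV p G /\ eqV (f a) (opair (elt c) p)}}}
        (fun u =>
           val G (elt (proj1_sig (projT2 (projT2 u)))))
  end.

(** Every pair in [t] has a structurally smaller first coordinate. *)
Lemma opair_elt (x s p : V) : eqV x (opair s p) ->
  exists (b : idx x) (c : idx (elt b)), eqV s (elt c) /\ eqV x (opair (elt c) p).
Proof.
  intros H.
  assert (Hb : inV (upair s s) x).
  { apply (inV_eq (eqV_refl (upair s s)) (eqV_sym H)), inV_upair.
    left; apply eqV_refl. }
  destruct Hb as [b Hb].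
  assert (Hc : inV s (elt b)).
  { apply (inV_eq (eqV_refl s) Hb), inV_upair; left; apply eqV_refl. }
  destruct Hc as [c Hc]; exists b, c; split; trivial.
  eapply eqV_trans; [exact H|]; apply opair_eq; auto using eqV_refl.
Qed.

Lemma val_eq G s t : eqV s t -> eqV (val G s) (val G t).
Proof.
  revert s t; fix IH 1; intros [A f] [B g] [H1 H2]; split.
  - intros [a [b [c [p [Hp E]]]]].
    destruct (H1 a) as [a' Ha].
    destruct (opair_elt (eqV_trans (eqV_sym Ha) E)) as [b' [c' [Hc E']]].
    exists (existT _ a' (existT _ b' (exist _ c' (ex_intro _ p (conj Hp E'))))).
    simpl; apply IH, Hc.
  - intros [a' [b' [c' [p [Hp E]]]]].
    destruct (H2 a') as [a Ha].
    destruct (opair_elt (eqV_trans Ha E)) as [b [c [Hc E']]].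
    exists (existT _ a (existT _ b (exist _ c (ex_intro _ p (conj Hp E'))))).
    simpl; apply IH, eqV_sym, Hc.
Qed.

Lemma inV_val G t y :
  inV y (val G t) <->
  exists s p, inV p G /\ inV (opair s p) t /\ eqV y (val G s).
Proof.
  split.
  - destruct t as [A f]; intros [[a [b [c [p [Hp Hc]]]]] Hy]; simpl in Hy.
    exists (elt c), p; repeat split; trivial.
    exists a; apply eqV_sym, Hc.
  - intros [s [p [Hp [[a Ha] Hy]]]]; destruct t as [A f].
    destruct (opair_elt (eqV_sym Ha : eqV (f a) _)) as [b [c [Hc E]]].
    exists (existT _ a (existT _ b (exist _ c (ex_intro _ p (conj Hp E))))); simpl.
    eapply eqV_trans; [exact Hy|]; apply val_eq, Hc.
Qed.

(** The generic extension [M[G]]. *)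
Definition generic_extension (M P G : V) : V :=
  @sup {a : idx M | is_name P (elt a)} (fun a => val G (elt (proj1_sig a))).

(** * Domination and total universality *)

Definition lt_star (x y : nat -> nat) : Prop :=
  exists N, forall n, N <= n -> x n < y n.

Definition dominating_over
    (R : (nat -> nat) -> (nat -> nat) -> Prop) (N : V) (d : nat -> nat) : Prop :=
  forall x : nat -> nat, inV (realV x) N -> R x d.

Definition universally_dominating_over
    (R : (nat -> nat) -> (nat -> nat) -> Prop) (M : V) (d : nat -> nat) : Prop :=
  forall P r : V, inV (opair P r) M -> forcing_notion P r ->
  exists G : V, generic M P r G /\
    dominating_over R (generic_extension M P G) d.

(** [T] is the fragment of ZF + DC whose transitive models are called models. *)
Definition total_universality
    (T : list form) (R : (nat -> nat) -> (nat -> nat) -> Prop) : Prop :=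
  forall M : V, set_model T M -> countableV M ->
  forall d : nat -> nat, dominating_over R M d ->
  universally_dominating_over R M d.

(* Main.v *)
Require Import Defs.
From Stdlib Require Import List Arith Lia Setoid Morphisms Classical.
From Stdlib Require Import ClassicalEpsilon.
Import ListNotations.

(** The generic filter is generated by a descending sequence of conditions, built
    together with a promise about the names handled so far.  The promise of a
    condition p from N on is a real z of M with z < d beyond N such that for every K
    some extension of p forces the handled reals to be below z on [N, K).  Given
    such a promise and a dense set D, there are, for every k, extensions q_k of p in D
    that respect z on [N, k).  By DC in M, all q_k can be fused: a single real h of M
    is, for every n, a promise of (an extension of) q_n from n on, since at each stage
    only finitely many of the q_k need to be strengthened to bound one more value.
    As d dominates h, it suffices to pass to q_n with n large: it secures the
    old promise below n, and h takes over from n on.  A new name can join the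
    handled ones at every stage.

    Only forcing statements "s = x" with x in the ground model are needed; they form
    a fixed point of a positive operator on sets of triples, unique by recursion
    on x. *)

(** The forcing notion is arbitrary and may add unbounded reals, so no condition need force a
    ground-model bound on a whole name. This is why a promise speaks only of finite windows [N, K),
    with the witnessing extension depending on K. Since d may lie outside M, the filter is built
    outside M; at each stage the choices that must happen in M (the candidates and h) are made
    without reference to d, which is consulted once, for the point beyond which h < d.

    The bookkeeping is separated from forcing. A bound system is a set of triples (q, k, m) with
    just the closure properties that the fusion uses; handling one more name shrinks this set, and
    the fusion itself never looks at names.

    For a fixed name the relevant forcing statements form a subset of a product set, so their
    relation comes from one Separation instance inside that product rather than from a recursion
    theorem in M. Hence finitely many axioms serve all names and all forcing notions. *)

#[local] Instance eqV_Equivalence : Equivalence eqV.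
Proof. split; [exact eqV_refl | exact eqV_sym | exact eqV_trans]. Qed.
#[local] Instance inV_Proper : Proper (eqV ==> eqV ==> iff) inV.
Proof.
  intros x x' Hx y y' Hy; split; apply inV_eq; auto; symmetry; auto.
Qed.
#[local] Instance upair_Proper : Proper (eqV ==> eqV ==> eqV) upair.
Proof. intros x x' Hx y y' Hy; apply upair_eq; auto. Qed.
#[local] Instance opair_Proper : Proper (eqV ==> eqV ==> eqV) opair.
Proof. intros x x' Hx y y' Hy; apply opair_eq; auto. Qed.
#[local] Instance leV_Proper : Proper (eqV ==> eqV ==> eqV ==> iff) leV.
Proof. intros r r' Hr x x' Hx y y' Hy; unfold leV; now rewrite Hr, Hx, Hy. Qed.
#[local] Instance val_Proper G : Proper (eqV ==> eqV) (val G).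
Proof. intros x x' Hx; apply val_eq, Hx. Qed.

#[local] Arguments eqV : simpl never.

(** * Well-foundedness, numerals and basic set operations on trees *)

Lemma inV_wf : well_founded inV.
Proof.
  intros x; induction x as [A f IH]; constructor; intros y [a Ha]; cbn in Ha.
  constructor; intros z Hz; rewrite Ha in Hz.
  exact (Acc_inv (IH a) Hz).
Qed.

Definition unionV (x : V) : V :=
  @sup {a : idx x & idx (elt a)} (fun u => elt (projT2 u)).

Lemma inV_unionV z x : inV z (unionV x) <-> exists y, inV y x /\ inV z y.
Proof.
  split.
  - intros [[a b] H]; exists (elt a); split; [apply inV_elt | exists b; exact H].
  - intros [y [[a Ha] Hz]]; rewrite Ha in Hz; destruct Hz as [b Hb].
    exists (existT _ a b); exact Hb.
Qed.

#[local] Instance unionV_Proper : Proper (eqV ==> eqV) unionV.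
Proof.
  intros x x' Hx; apply eqV_ext; intros z; rewrite !inV_unionV.
  split; intros [y [Hy Hz]]; exists y; split; trivial; [rewrite <- Hx | rewrite Hx]; exact Hy.
Qed.

Lemma inV_succV z x : inV z (succV x) <-> inV z x \/ eqV z x.
Proof.
  split.
  - intros [[a|] H]; [left; exists a | right]; exact H.
  - intros [[a H]|H]; [exists (Some a) | exists None]; exact H.
Qed.

#[local] Instance succV_Proper : Proper (eqV ==> eqV) succV.
Proof.
  intros x x' Hx; apply eqV_ext; intros z; rewrite !inV_succV; now rewrite Hx.
Qed.

Lemma inV_emptyV z : ~ inV z emptyV.
Proof. intros [[] _]. Qed.

Lemma inV_numV z n : inV z (numV n) <-> exists i, i < n /\ eqV z (numV i).
Proof.
  induction n as [|n IH]; cbn [numV].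
  - split; [intros H; destruct (inV_emptyV _ H) | intros [i [Hi _]]; lia].
  - rewrite inV_succV, IH; split.
    + intros [[i [Hi H]]|H]; eauto with arith.
    + intros [i [Hi H]]; destruct (Nat.eq_dec i n) as [->|]; auto.
      left; exists i; split; [lia | exact H].
Qed.

Lemma inV_irrefl x : ~ inV x x.
Proof.
  induction (inV_wf x) as [x _ IH]; intros H; exact (IH x H H).
Qed.

Lemma numV_inj m n : eqV (numV m) (numV n) -> m = n.
Proof.
  intros H; destruct (lt_eq_lt_dec m n) as [[L|E]|L]; trivial; exfalso.
  - apply (@inV_irrefl (numV n)); rewrite <- H at 1; apply inV_numV; exists m; split; [lia|reflexivity].
  - apply (@inV_irrefl (numV m)); rewrite H at 1; apply inV_numV; exists n; split; [lia|reflexivity].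
Qed.

Lemma inV_numV_numV m n : inV (numV m) (numV n) <-> m < n.
Proof.
  rewrite inV_numV; split.
  - intros [i [Hi H]]; apply numV_inj in H; lia.
  - intros H; exists m; split; [exact H | reflexivity].
Qed.

Definition omegaV : V := @sup nat numV.

Lemma inV_omegaV z : inV z omegaV <-> exists n, eqV z (numV n).
Proof. reflexivity. Qed.

Lemma numV_omegaV n : inV (numV n) omegaV.
Proof. exists n; reflexivity. Qed.

Lemma inV_realV z x : inV z (realV x) <-> exists n, eqV z (opair (numV n) (numV (x n))).
Proof. reflexivity. Qed.

Lemma opair_numV_realV n m x : inV (opair (numV n) (numV m)) (realV x) <-> m = x n.
Proof.
  rewrite inV_realV; split.
  - intros [i H]; apply opair_inj in H; destruct H as [H1 H2].
    apply numV_inj in H1; apply numV_inj in H2; congruence.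
  - intros ->; exists n; reflexivity.
Qed.

Definition prodV (x y : V) : V :=
  @sup (idx x * idx y) (fun u => opair (elt (fst u)) (elt (snd u))).

Lemma inV_prodV z x y :
  inV z (prodV x y) <-> exists a b, inV a x /\ inV b y /\ eqV z (opair a b).
Proof.
  split.
  - intros [[a b] H]; exists (elt a), (elt b); auto using inV_elt.
  - intros [a [b [[i Hi] [[j Hj] H]]]]; exists (i, j); cbn.
    rewrite H; apply opair_eq; auto.
Qed.

Lemma opair_prodV a b x y : inV (opair a b) (prodV x y) <-> inV a x /\ inV b y.
Proof.
  rewrite inV_prodV; split.
  - intros [a' [b' [Ha [Hb H]]]]; apply opair_inj in H; destruct H as [H1 H2].
    rewrite H1, H2; auto.
  - intros [Ha Hb]; exists a, b; split; [exact Ha | split; [exact Hb | reflexivity]].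
Qed.

(** Written through [unionV] and [upair] so that closure of a model under it is immediate from Union
    and Pairing. *)
Definition adjoin (x y : V) : V := unionV (upair x (upair y y)).

Lemma inV_adjoin z x y : inV z (adjoin x y) <-> inV z x \/ eqV z y.
Proof.
  unfold adjoin; rewrite inV_unionV; split.
  - intros [w [Hw Hz]]; apply inV_upair in Hw; destruct Hw as [Hw|Hw]; rewrite Hw in Hz; auto.
    apply inV_upair in Hz; tauto.
  - intros [H|H]; [exists x | exists (upair y y)]; rewrite !inV_upair;
      (split; [|auto]); [left|right]; reflexivity.
Qed.

(** * Truth of formulas in transitive sets *)

(** A computable form of [free]: the side conditions of the axiom schemes then hold by
    evaluation. *)
Fixpoint freeb (v : nat) (A : form) : bool :=
  match A with
  | fMem i j | fEq i j => (Nat.eqb v i || Nat.eqb v j)%bool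
  | fNot A => freeb v A
  | fAnd A B | fOr A B | fImp A B | fIff A B => (freeb v A || freeb v B)%bool
  | fAll i A | fEx i A => (negb (Nat.eqb v i) && freeb v A)%bool
  end.

Lemma freeb_spec v A : freeb v A = true <-> free v A.
Proof.
  induction A; cbn; rewrite ?Bool.orb_true_iff, ?Bool.andb_true_iff,
    ?Bool.negb_true_iff, ?Nat.eqb_eq, ?Nat.eqb_neq; tauto.
Qed.

Lemma not_free v A : freeb v A = false -> ~ free v A.
Proof. rewrite <- freeb_spec; congruence. Qed.

Lemma sat_ext M A : forall e e',
  (forall v, free v A -> eqV (e v) (e' v)) -> sat M e A <-> sat M e' A.
Proof.
  induction A; intros e e' H; cbn in *.
  - now rewrite (H i), (H j) by auto.
  - now rewrite (H i), (H j) by auto.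
  - now rewrite (IHA e e').
  - now rewrite (IHA1 e e'), (IHA2 e e') by auto.
  - now rewrite (IHA1 e e'), (IHA2 e e') by auto.
  - now rewrite (IHA1 e e'), (IHA2 e e') by auto.
  - now rewrite (IHA1 e e'), (IHA2 e e') by auto.
  - assert (K : forall x, sat M (upd e i x) A <-> sat M (upd e' i x) A).
    { intros x; apply IHA; intros v Hv; unfold upd.
      destruct (Nat.eqb_spec v i); [reflexivity | auto]. }
    split; intros L x Hx; apply K; auto.
  - assert (K : forall x, sat M (upd e i x) A <-> sat M (upd e' i x) A).
    { intros x; apply IHA; intros v Hv; unfold upd.
      destruct (Nat.eqb_spec v i); [reflexivity | auto]. }
    split; intros [x [Hx L]]; exists x; split; auto; apply K; auto.
Qed.

Lemma upd_same e i x : upd e i x i = x.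
Proof. unfold upd; now rewrite Nat.eqb_refl. Qed.

Lemma upd_lt e i x j : j < i -> upd e i x j = e j.
Proof. intros H; unfold upd; destruct (Nat.eqb_spec j i); [lia | trivial]. Qed.

(* Parameters are the variables from 5 on, as the axiom schemes bind 0 to 4.  In the
   formulas below, bound variables start at 20, and those of the abbreviations at 40. *)
Definition params (l : list V) : nat -> V := fun i => nth (i - 5) l emptyV.

Definition tri_in (k q x y c : nat) : form :=
  (∃ k, k ∈ c ∧ ∃ (k+1), is_opair (k+2) k q (k+1) ∧ is_opair (k+2) (k+1) x y)%form.
Definition is_tri (k p q x y : nat) : form :=
  (∃ k, is_opair (k+1) p q k ∧ is_opair (k+1) k x y)%form.
Definition is_union (k v w : nat) : form :=
  (∀ k, k ∈ v ⇔ ∃ (k+1), (k+1) ∈ w ∧ k ∈ (k+1))%form.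

Section Semantics.
Variable M : V.
Hypothesis Mtrans : transitiveV M.
Hypothesis Mpair : forall x y, inV x M -> inV y M -> inV (upair x y) M.

Lemma opair_closed x y : inV x M -> inV y M -> inV (opair x y) M.
Proof. intros; unfold opair; auto. Qed.

Lemma M_opair_inv x y : inV (opair x y) M -> inV x M /\ inV y M.
Proof.
  intros H; assert (K : inV (upair x y) M).
  { apply (Mtrans _ (opair x y)); trivial; apply inV_upair; right; reflexivity. }
  split; apply (Mtrans _ (upair x y)); trivial; apply inV_upair; [left|right]; reflexivity.
Qed.

Lemma M_ext x y : inV x M -> inV y M ->
  (forall z, inV z M -> (inV z x <-> inV z y)) -> eqV x y.
Proof.
  intros Hx Hy H; apply eqV_ext; intros z; split; intros Hz;
    apply H; trivial; eapply Mtrans; eauto.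
Qed.

(** Absoluteness for transitive sets, the pattern of all translation lemmas below: members of
    elements of [M] are in [M], so quantifying over [M] determines a set. The inequalities keep the
    bound variables, which start at [k], from capturing the arguments. *)
Lemma sat_is_upair e k z x y : z < k -> x < k -> y < k ->
  inV (e z) M -> inV (e x) M -> inV (e y) M ->
  sat M e (is_upair k z x y) <-> eqV (e z) (upair (e x) (e y)).
Proof.
  intros Lz Lx Ly Hz Hx Hy; cbn; split.
  - intros H; apply M_ext; auto; intros u Hu; specialize (H u Hu).
    rewrite upd_same, !upd_lt in H by trivial; rewrite inV_upair; exact H.
  - intros H u Hu; rewrite upd_same, !upd_lt by trivial; rewrite H; apply inV_upair.
Qed.

Lemma sat_is_opair e k p x y : p < k -> x < k -> y < k ->
  inV (e p) M -> inV (e x) M -> inV (e y) M ->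
  sat M e (is_opair k p x y) <-> eqV (e p) (opair (e x) (e y)).
Proof.
  intros Lp Lx Ly Hp Hx Hy; unfold is_opair.
  assert (K : forall u, inV u M ->
    sat M (upd e k u) (is_upair (k+1) k x x ∨ is_upair (k+1) k x y) <->
    inV u (opair (e x) (e y))).
  { intros u Hu; cbn [sat].
    rewrite !sat_is_upair; rewrite ?upd_same, ?upd_lt; trivial; try lia.
    unfold opair; rewrite inV_upair; reflexivity. }
  split.
  - intros H; apply M_ext; auto using opair_closed; intros u Hu; rewrite <- K by trivial.
    specialize (H u Hu); cbn in H; rewrite upd_same, upd_lt in H by trivial; exact H.
  - intros H u Hu; cbn [sat]; rewrite upd_same, upd_lt by trivial.
    rewrite H; symmetry; apply (K u Hu).
Qed.

Lemma sat_is_succ e k s n : s < k -> n < k -> inV (e s) M -> inV (e n) M ->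
  sat M e (is_succ k s n) <-> eqV (e s) (succV (e n)).
Proof.
  intros Ls Ln Hs Hn; cbn; split.
  - intros H; apply eqV_ext; intros u; rewrite inV_succV; split.
    + intros Hu; specialize (H u (Mtrans _ _ Hu Hs)).
      rewrite upd_same, !upd_lt in H by trivial; apply H, Hu.
    + intros Hu; assert (HuM : inV u M).
      { destruct Hu as [Hu| ->]; eauto. }
      specialize (H u HuM).
      rewrite upd_same, !upd_lt in H by trivial; apply H, Hu.
  - intros H u Hu; rewrite upd_same, !upd_lt by trivial; rewrite H; apply inV_succV.
Qed.

Lemma sat_is_empty e k x : x < k -> inV (e x) M ->
  sat M e (is_empty k x) <-> eqV (e x) emptyV.
Proof.
  intros L H; cbn; split.
  - intros K; apply eqV_ext; intros z; split; intros Hz.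
    + specialize (K z (Mtrans _ _ Hz H)); rewrite upd_same, upd_lt in K by trivial; tauto.
    + destruct (inV_emptyV _ Hz).
  - intros K u Hu; rewrite upd_same, upd_lt by trivial; rewrite K; apply inV_emptyV.
Qed.

Lemma sat_is_union e k v w : v < k -> w < k -> inV (e v) M -> inV (e w) M ->
  sat M e (is_union k v w) <-> eqV (e v) (unionV (e w)).
Proof.
  intros Lv Lw Hv Hw; unfold is_union; cbn.
  assert (K : forall u, inV u M -> (exists y, inV y M /\
     inV (upd (upd e k u) (k+1) y (k+1)) (upd (upd e k u) (k+1) y w) /\
     inV (upd (upd e k u) (k+1) y k) (upd (upd e k u) (k+1) y (k+1))) <->
     inV u (unionV (e w))).
  { intros u Hu; rewrite inV_unionV; split.
    - intros [y Hy]; exists y; rewrite !upd_same in Hy.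
      rewrite !(@upd_lt _ (k+1)), upd_same, upd_lt in Hy by lia; tauto.
    - intros [y Hy]; exists y; rewrite !upd_same.
      rewrite !(@upd_lt _ (k+1)), upd_same, upd_lt by lia; intuition eauto. }
  split.
  - intros H; apply eqV_ext; intros u; split; intros Hu.
    + assert (HuM : inV u M) by eauto.
      apply K, H; trivial; rewrite upd_same, upd_lt by trivial; exact Hu.
    + assert (HuM : inV u M). { apply inV_unionV in Hu; destruct Hu as [y [Hy Hu]]; eauto. }
      apply K in Hu; trivial; apply H in Hu; trivial.
      rewrite upd_same, upd_lt in Hu by trivial; exact Hu.
  - intros H u Hu; rewrite upd_same, upd_lt by trivial; rewrite H; symmetry; apply K, Hu.
Qed.

Lemma sat_opair_in e k x y r : x < k -> y < k -> r < k ->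
  inV (e x) M -> inV (e y) M -> inV (e r) M ->
  sat M e (opair_in k x y r) <-> inV (opair (e x) (e y)) (e r).
Proof.
  intros Lx Ly Lr Hx Hy Hr; unfold opair_in; cbn [sat]; split.
  - intros [u [Hu [K1 K2]]].
    apply sat_is_opair in K2; rewrite ?upd_same, ?upd_lt in * by lia; trivial; try lia.
    rewrite <- K2; exact K1.
  - intros H; exists (opair (e x) (e y)); split; [eauto using opair_closed|].
    rewrite sat_is_opair; rewrite ?upd_same, ?upd_lt by lia; auto using opair_closed; try lia.
    split; [exact H | reflexivity].
Qed.

Lemma sat_is_tri e k p q x y : p < k -> q < k -> x < k -> y < k ->
  inV (e p) M -> inV (e q) M -> inV (e x) M -> inV (e y) M ->
  sat M e (is_tri k p q x y) <-> eqV (e p) (opair (e q) (opair (e x) (e y))).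
Proof.
  intros Lp Lq Lx Ly Hp Hq Hx Hy; unfold is_tri; cbn [sat]; split.
  - intros [u [Hu [K1 K2]]]; apply sat_is_opair in K1; apply sat_is_opair in K2;
      rewrite ?upd_same, ?upd_lt in * by lia; trivial; try lia.
    rewrite K1, K2; reflexivity.
  - intros H; exists (opair (e x) (e y)); split; [auto using opair_closed|].
    rewrite !sat_is_opair; rewrite ?upd_same, ?upd_lt by lia; auto using opair_closed; try lia.
    split; [exact H | reflexivity].
Qed.

Lemma sat_tri_in e k q x y c : q < k -> x < k -> y < k -> c < k ->
  inV (e q) M -> inV (e x) M -> inV (e y) M -> inV (e c) M ->
  sat M e (tri_in k q x y c) <-> inV (opair (e q) (opair (e x) (e y))) (e c).
Proof.
  intros Lq Lx Ly Lc Hq Hx Hy Hc; unfold tri_in; cbn [sat]; split.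
  - intros [u [Hu [K1 [v [Hv [K2 K3]]]]]]; apply sat_is_opair in K2; apply sat_is_opair in K3;
      rewrite ?upd_same in *; rewrite ?(@upd_lt _ (k+1)) in * by lia;
      rewrite ?upd_same, ?upd_lt in * by lia; trivial; try lia.
    rewrite <- K3, <- K2; exact K1.
  - intros H; exists (opair (e q) (opair (e x) (e y))); split; [auto using opair_closed|].
    rewrite upd_same, upd_lt by trivial; split; trivial.
    exists (opair (e x) (e y)); split; [auto using opair_closed|].
    rewrite !sat_is_opair; rewrite ?upd_same; rewrite ?(@upd_lt _ (k+1)) by lia;
      rewrite ?upd_same, ?upd_lt by lia; auto using opair_closed; try lia.
    split; reflexivity.
Qed.

(** These congruences let a formula be compared with its intended meaning one connective at a
    time. *)
Lemma sat_and e A B P Q : (sat M e A <-> P) -> (sat M e B <-> Q) ->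
  sat M e (fAnd A B) <-> P /\ Q.
Proof. cbn; tauto. Qed.
Lemma sat_or e A B P Q : (sat M e A <-> P) -> (sat M e B <-> Q) ->
  sat M e (fOr A B) <-> P \/ Q.
Proof. cbn; tauto. Qed.
Lemma sat_imp e A B P Q : (sat M e A <-> P) -> (sat M e B <-> Q) ->
  sat M e (fImp A B) <-> (P -> Q).
Proof. cbn; tauto. Qed.
Lemma sat_iff e A B P Q : (sat M e A <-> P) -> (sat M e B <-> Q) ->
  sat M e (fIff A B) <-> (P <-> Q).
Proof. cbn; tauto. Qed.
Lemma sat_not e A P : (sat M e A <-> P) -> sat M e (fNot A) <-> ~ P.
Proof. cbn; tauto. Qed.
Lemma sat_all e i A P : (forall x, inV x M -> (sat M (upd e i x) A <-> P x)) ->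
  sat M e (fAll i A) <-> forall x, inV x M -> P x.
Proof. cbn; intros H; split; intros K x Hx; apply H; auto. Qed.
Lemma sat_ex e i A P : (forall x, inV x M -> (sat M (upd e i x) A <-> P x)) ->
  sat M e (fEx i A) <-> exists x, inV x M /\ P x.
Proof. cbn; intros H; split; intros [x [Hx K]]; exists x; split; trivial; apply H; auto. Qed.

(** With 1 and 2 not free in [A], the outer variables of the scheme do not affect the truth of [A],
    which can then be evaluated at [params l] with only 0 updated. *)
Lemma separation A l b : satisfies M (Separation A) ->
  freeb 1 A = false -> freeb 2 A = false ->
  inV emptyV M -> Forall (fun x => inV x M) l -> inV b M ->
  exists c, inV c M /\
    forall x, inV x c <-> inV x b /\ sat M (upd (params l) 0 x) A.
Proof.
  intros HA F1 F2 H0 Hl Hb; apply not_free in F1; apply not_free in F2.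
  assert (He : forall i, inV (params l i) M).
  { intros i; unfold params; destruct (nth_in_or_default (i - 5) l emptyV) as [H| ->]; trivial.
    rewrite Forall_forall in Hl; auto. }
  destruct (HA _ He b Hb) as [c [Hc K]]; exists c; split; trivial; intros x.
  assert (E : sat M (upd (upd (upd (params l) 1 b) 2 c) 0 x) A <->
              sat M (upd (params l) 0 x) A).
  { apply sat_ext; intros v Hv; unfold upd; destruct (Nat.eqb_spec v 0); [reflexivity|].
    destruct (Nat.eqb_spec v 2); [subst; tauto|].
    destruct (Nat.eqb_spec v 1); [subst; tauto|reflexivity]. }
  cbn in K; unfold upd at 1 2 3 4 in K; cbn in K.
  rewrite <- E; split.
  - intros Hx; apply K; eauto.
  - intros Hx; apply K; trivial; destruct Hx; eauto.
Qed.

Lemma replacement A l b : satisfies M (Replacement A) ->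
  freeb 2 A = false -> freeb 3 A = false -> freeb 4 A = false ->
  inV emptyV M -> Forall (fun x => inV x M) l -> inV b M ->
  (forall x, inV x b -> exists z, inV z M /\ forall y, inV y M ->
     (sat M (upd (upd (params l) 0 x) 1 y) A <-> eqV y z)) ->
  exists c, inV c M /\
    forall y, inV y c <-> inV y M /\
      exists x, inV x b /\ sat M (upd (upd (params l) 0 x) 1 y) A.
Proof.
  intros HA F2 F3 F4 H0 Hl Hb Hfun.
  apply not_free in F2; apply not_free in F3; apply not_free in F4.
  assert (He : forall i, inV (params l i) M).
  { intros i; unfold params; destruct (nth_in_or_default (i - 5) l emptyV) as [H| ->]; trivial.
    rewrite Forall_forall in Hl; auto. }
  destruct (HA _ He b Hb) as [c [Hc K]].
  - intros x Hx Hxb; cbn in Hxb; destruct (Hfun x Hxb) as [z [Hz L]].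
    exists z; split; trivial; intros y Hy; cbn; unfold upd at 5 6; cbn.
    rewrite <- (L y Hy); apply sat_ext; intros v Hv; unfold upd.
    destruct (Nat.eqb_spec v 1); [reflexivity|].
    destruct (Nat.eqb_spec v 4); [subst; tauto|].
    destruct (Nat.eqb_spec v 0); [reflexivity|].
    destruct (Nat.eqb_spec v 2); [subst; tauto|reflexivity].
  - exists c; split; trivial.
    assert (E : forall x y,
      sat M (upd (upd (upd (upd (params l) 2 b) 3 c) 1 y) 0 x) A <->
      sat M (upd (upd (params l) 0 x) 1 y) A).
    { intros x y; apply sat_ext; intros v Hv; unfold upd.
      destruct (Nat.eqb_spec v 0) as [->|]; [reflexivity|].
      destruct (Nat.eqb_spec v 1); [reflexivity|].
      destruct (Nat.eqb_spec v 3); [subst; tauto|].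
      destruct (Nat.eqb_spec v 2); [subst; tauto|reflexivity]. }
    intros y; split.
    + intros Hy; split; [eauto|].
      apply (K y) in Hy; [|eauto]; destruct Hy as [x [Hx [Hxb Hs]]].
      exists x; split; [exact Hxb | apply E, Hs].
    + intros [Hy [x [Hx Hs]]]; apply (K y Hy); exists x; split; [eauto|].
      split; [exact Hx | apply E, Hs].
Qed.

End Semantics.

(** * The formulas used in Separation and Replacement, and the finite fragment *)

Definition phi_neq : form := (¬ 0 ≐ 5)%form.
Definition phi_prod : form :=
  (∃ 20, 20 ∈ 5 ∧ ∃ 21, 21 ∈ 6 ∧ is_opair 40 0 20 21)%form.
(** Variable 1 is the iterated union of parameter 5 taken 0 many times, 0 being a numeral. Variable
    20 is an attempt at the recursion: a set of pairs, each of which is the initial pair or is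
    justified by another pair of the attempt. *)
Definition phi_tc : form :=
  (∃ 20, opair_in 40 0 1 20 ∧ ∀ 21, ∀ 22, opair_in 40 21 22 20 ⇒
     (is_empty 40 21 ∧ 22 ≐ 5) ∨
     (∃ 23, ∃ 24, opair_in 40 23 24 20 ∧ is_succ 40 21 23 ∧ is_union 40 22 24))%form.
(** The internal form of [clause]; [E] is an argument because [phi_force] quantifies over it. *)
Definition clause_form (E p s x r : nat) : form :=
  ((∀ 23, ∀ 24, ∀ 25, opair_in 40 23 24 s ⇒ opair_in 40 25 p r ⇒ opair_in 40 25 24 r ⇒
      ∃ 26, ∃ 27, opair_in 40 26 25 r ∧ 27 ∈ x ∧ tri_in 40 26 23 27 E) ∧
   (∀ 23, ∀ 24, 23 ∈ x ⇒ opair_in 40 24 p r ⇒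
      ∃ 25, ∃ 26, ∃ 27, opair_in 40 25 24 r ∧ opair_in 40 25 27 r ∧
        opair_in 40 26 27 s ∧ tri_in 40 25 26 23 E))%form.
Definition phi_force : form :=
  (∃ 28, 0 ∈ 28 ∧ ∀ 20, ∀ 21, ∀ 22, tri_in 40 20 21 22 28 ⇒ clause_form 28 20 21 22 5)%form.
Definition phi_decide : form :=
  (0 ∈ 6 ∨ ∀ 20, opair_in 40 20 0 5 ⇒ ¬ 20 ∈ 6)%form.
Definition phi_member : form :=
  (∃ 20, 20 ∈ 7 ∧ tri_in 40 0 6 20 5)%form.
Definition phi_attain : form :=
  (∃ 20, ∃ 21, opair_in 40 20 21 7 ∧ opair_in 40 0 21 5 ∧ tri_in 40 0 20 8 6)%form.
Definition phi_fail : form :=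
  ((∃ 20, ∃ 21, opair_in 40 20 21 7 ∧ opair_in 40 0 21 5 ∧
      ∀ 22, ∀ 23, opair_in 40 22 0 5 ⇒ 23 ∈ 8 ⇒ ¬ tri_in 40 22 20 23 6) ∨
   (∃ 20, 20 ∈ 8 ∧ ∀ 21, ∀ 22, ∀ 23, opair_in 40 21 0 5 ⇒ opair_in 40 21 23 5 ⇒
      opair_in 40 22 23 7 ⇒ ¬ tri_in 40 21 22 20 6))%form.
(** A strong way for [q] to force (k, m) into the value of [t]: one pair (30, 31) of [t] has [q]
    below 31, and [q] forces 30 to equal (k, m). *)
Definition dec_form (t r E q k m : nat) : form :=
  (∃ 30, ∃ 31, ∃ 32, opair_in 40 30 31 t ∧ opair_in 40 q 31 r ∧
     is_opair 40 32 k m ∧ tri_in 40 q 30 32 E)%form.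
Definition phi_handle : form :=
  (∃ 20, ∃ 21, ∃ 22, is_tri 40 0 20 21 22 ∧
     ((∃ 23, 23 ∈ 22 ∧ dec_form 5 6 7 20 21 23) ∨
      (∀ 23, ∀ 24, opair_in 40 23 20 6 ⇒ 24 ∈ 8 ⇒ ¬ dec_form 5 6 7 23 21 24)))%form.
Definition phi_base : form :=
  (∃ 20, ∃ 21, ∃ 22, is_tri 40 0 20 21 22 ∧
     (∀ 23, ∀ 24, opair_in 40 23 24 21 ⇒ 23 ∈ 20) ∧
     (∀ 23, ∀ 24, ∀ 25, opair_in 40 23 24 21 ⇒ opair_in 40 23 25 21 ⇒ 24 ≐ 25))%form.
(** The internal form of [next_map] for pairs of triples (k, g, m), (k+1, g', m'); the parameters 5,
    6, 7 are [r], [C], [Q]. *)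
Definition phi_next : form :=
  (∃ 20, ∃ 21, ∃ 22, ∃ 23, ∃ 24, ∃ 25, ∃ 26, ∃ 27,
     is_opair 40 0 20 21 ∧ is_tri 40 20 22 23 24 ∧ is_tri 40 21 25 26 27 ∧
     is_succ 40 25 22 ∧
     (∀ 28, ∀ 29, opair_in 40 28 29 23 ⇒ ∃ 30, opair_in 40 30 29 5 ∧ opair_in 40 28 30 26) ∧
     (∃ 28, ∃ 29, opair_in 40 22 28 7 ∧ opair_in 40 29 28 5 ∧ opair_in 40 22 29 26) ∧
     (∀ 28, ∀ 29, opair_in 40 28 29 26 ⇒ tri_in 40 29 22 27 6))%form.
(** Defines in M the function [h] of [common_bound] from the graph of the fusion sequence (5) and
    its starting index (6). The bound for k stands in the entry with first coordinate k+1, because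
    it is produced by the step that leaves k. *)
Definition phi_bound : form :=
  (∃ 20, ∃ 21, is_opair 40 0 20 21 ∧
     ((20 ∈ 6 ∧ is_empty 40 21) ∨
      (¬ 20 ∈ 6 ∧ ∃ 22, ∃ 23, ∃ 24, ∃ 25, opair_in 40 22 23 5 ∧
         is_tri 40 23 24 25 21 ∧ is_succ 40 24 20)))%form.
Definition phi_start : form :=
  (∃ 20, ∃ 21, is_opair 40 0 20 21 ∧ 21 ∈ 5 ∧ opair_in 40 21 6 7 ∧
     ∀ 22, 22 ∈ 20 ⇒ ¬ 22 ∈ 8 ⇒ ∃ 23, opair_in 40 22 23 9 ∧ tri_in 40 21 22 23 10)%form.

Definition separation_forms : list form :=
  [phi_neq; phi_prod; phi_force; phi_decide; phi_member; phi_attain; phi_fail;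
   phi_handle; phi_base; phi_next; phi_bound; phi_start].

Definition fragment : list form :=
  [Powerset; Pairing; Union; DependentChoice; Replacement phi_tc]
    ++ map Separation separation_forms.

Lemma fragment_finite : finite_fragment fragment.
Proof.
  split; [|left; trivial].
  unfold fragment; intros A HA; apply in_app_or in HA; destruct HA as [HA|HA].
  - cbn [In] in HA; destruct HA as [<-|[<-|[<-|[<-|[<-|[]]]]]]; constructor;
      apply not_free; reflexivity.
  - apply in_map_iff in HA; destruct HA as [B [<- HB]]; constructor.
    assert (K : forallb (fun B => negb (freeb 2 B)) separation_forms = true) by reflexivity.
    rewrite forallb_forall in K; apply not_free, Bool.negb_true_iff, K, HB.
Qed.

(** * Closure properties of models *)

Section Model.
Variable M : V.
Hypothesis Mne : exists x, inV x M.
Hypothesis Mtrans : transitiveV M.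
Hypothesis Mfrag : forall A, In A fragment -> satisfies M A.

(** Descending along membership from any element stays in the transitive [M] and must end at the
    empty set. *)
Lemma M_emptyV : inV emptyV M.
Proof.
  destruct Mne as [x Hx]; induction (inV_wf x) as [x _ IH].
  destruct (classic (exists y, inV y x)) as [[y Hy]|H]; [eauto|].
  assert (E : eqV x emptyV).
  { apply eqV_ext; intros z; split; intros Hz; [exfalso; eauto | destruct (inV_emptyV _ Hz)]. }
  rewrite <- E; exact Hx.
Qed.

Lemma params_M l : Forall (fun x => inV x M) l -> forall i, inV (params l i) M.
Proof.
  intros Hl i; unfold params; destruct (nth_in_or_default (i - 5) l emptyV) as [H| ->].
  - rewrite Forall_forall in Hl; auto.
  - apply M_emptyV.
Qed.

Lemma M_upair x y : inV x M -> inV y M -> inV (upair x y) M.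
Proof.
  intros Hx Hy; assert (HA : satisfies M Pairing) by (apply Mfrag; cbn; auto).
  destruct (HA (params []) (params_M [] (Forall_nil _)) x Hx y Hy) as [z [Hz K]]; cbn in K.
  assert (E : eqV z (upair x y)); [|rewrite <- E; exact Hz].
  apply eqV_ext; intros u; rewrite inV_upair; split.
  - intros Hu; apply K; eauto.
  - intros Hu; apply K; trivial; destruct Hu as [E|E]; rewrite E; trivial.
Qed.

Lemma M_unionV x : inV x M -> inV (unionV x) M.
Proof.
  intros Hx; assert (HA : satisfies M Union) by (apply Mfrag; cbn; auto).
  destruct (HA (params []) (params_M [] (Forall_nil _)) x Hx) as [z [Hz K]]; cbn in K.
  assert (E : eqV z (unionV x)); [|rewrite <- E; exact Hz].
  apply eqV_ext; intros u; rewrite inV_unionV; split.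
  - intros Hu; apply K in Hu; [|eauto]; destruct Hu as [y [_ Hy]]; eauto.
  - intros [y [Hy Hu]]; apply K; eauto.
Qed.

Lemma M_powerset x : inV x M ->
  exists w, inV w M /\ forall z, inV z w <-> inV z M /\ subV z x.
Proof.
  intros Hx; assert (HA : satisfies M Powerset) by (apply Mfrag; cbn; auto).
  destruct (HA (params []) (params_M [] (Forall_nil _)) x Hx) as [w [Hw K]]; cbn in K.
  exists w; split; trivial; intros z; split.
  - intros Hz; assert (HzM : inV z M) by eauto; split; trivial; intros u Hu.
    exact (proj1 (K z HzM) Hz u (Mtrans _ _ Hu HzM) Hu).
  - intros [Hz S]; apply K; auto.
Qed.

Lemma M_adjoin x y : inV x M -> inV y M -> inV (adjoin x y) M.
Proof. intros; apply M_unionV; auto using M_upair. Qed.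

Lemma M_opair x y : inV x M -> inV y M -> inV (opair x y) M.
Proof. apply opair_closed; exact M_upair. Qed.

Lemma M_succV x : inV x M -> inV (succV x) M.
Proof.
  intros Hx; assert (E : eqV (succV x) (adjoin x x)); [|rewrite E; auto using M_adjoin].
  apply eqV_ext; intros z; now rewrite inV_succV, inV_adjoin.
Qed.

Lemma M_numV n : inV (numV n) M.
Proof. induction n; [exact M_emptyV | apply M_succV, IHn]. Qed.

Lemma M_separation A l b : In A separation_forms ->
  Forall (fun x => inV x M) l -> inV b M ->
  exists c, inV c M /\
    forall x, inV x c <-> inV x b /\ sat M (upd (params l) 0 x) A.
Proof.
  intros HA Hl Hb.
  assert (K : forallb (fun B => negb (freeb 1 B || freeb 2 B)) separation_forms = true)
    by reflexivity.
  rewrite forallb_forall in K; specialize (K A HA).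
  apply Bool.negb_true_iff, Bool.orb_false_iff in K; destruct K as [K1 K2].
  apply separation; trivial; [|exact M_emptyV].
  apply Mfrag; unfold fragment; apply in_or_app; right; apply in_map, HA.
Qed.

Ltac head_of t := lazymatch t with ?f _ => head_of f | _ => t end.
Ltac sem_side :=
  first [ lia | assumption
        | cbv [upd params nth Nat.eqb Nat.sub Nat.add]; first [assumption | reflexivity] ].
(** Proves that a formula holds in [M] iff its hand-written translation does. Abbreviations with a
    translation lemma are caught before the connectives; any other defined formula is unfolded. The
    quantifier cases introduce the facts [inV x M] that the side conditions then find. *)
Ltac sem :=
  lazymatch goal with
  | |- sat _ _ (is_upair _ _ _ _) <-> _ => apply (sat_is_upair M Mtrans); sem_side
  | |- sat _ _ (is_opair _ _ _ _) <-> _ => apply (sat_is_opair M Mtrans M_upair); sem_side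
  | |- sat _ _ (is_succ _ _ _) <-> _ => apply (sat_is_succ M Mtrans); sem_side
  | |- sat _ _ (is_empty _ _) <-> _ => apply (sat_is_empty M Mtrans); sem_side
  | |- sat _ _ (is_union _ _ _) <-> _ => apply (sat_is_union M Mtrans); sem_side
  | |- sat _ _ (opair_in _ _ _ _) <-> _ => apply (sat_opair_in M Mtrans M_upair); sem_side
  | |- sat _ _ (is_tri _ _ _ _ _) <-> _ => apply (sat_is_tri M Mtrans M_upair); sem_side
  | |- sat _ _ (tri_in _ _ _ _ _) <-> _ => apply (sat_tri_in M Mtrans M_upair); sem_side
  | |- sat _ _ (fMem _ _) <-> _ => reflexivity
  | |- sat _ _ (fEq _ _) <-> _ => reflexivity
  | |- sat _ _ (fNot _) <-> _ => apply sat_not; sem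
  | |- sat _ _ (fAnd _ _) <-> _ => apply sat_and; sem
  | |- sat _ _ (fOr _ _) <-> _ => apply sat_or; sem
  | |- sat _ _ (fImp _ _) <-> _ => apply sat_imp; sem
  | |- sat _ _ (fIff _ _) <-> _ => apply sat_iff; sem
  | |- sat _ _ (fAll _ _) <-> _ => apply sat_all; intros ? ?; sem
  | |- sat _ _ (fEx _ _) <-> _ => apply sat_ex; intros ? ?; sem
  | |- sat _ _ ?A <-> _ => let h := head_of A in unfold h; sem
  end.

(** Kuratowski pairs over [a] and [b] lie in the double power set of their union, as computed in
    [M]. *)
Lemma M_prodV a b : inV a M -> inV b M -> inV (prodV a b) M.
Proof.
  intros Ha Hb.
  destruct (M_powerset (unionV (upair a b))) as [w [Hw Kw]]; [auto using M_unionV, M_upair|].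
  destruct (M_powerset w Hw) as [u [Hu Ku]].
  destruct (M_separation phi_prod [a; b] u) as [c [Hc Kc]]; [cbn; tauto | auto | trivial |].
  assert (E : eqV c (prodV a b)); [|rewrite <- E; exact Hc].
  apply eqV_ext; intros x; rewrite Kc, inV_prodV.
  assert (S : inV x M -> sat M (upd (params [a; b]) 0 x) phi_prod <->
    exists y, inV y M /\ inV y a /\ exists z, inV z M /\ inV z b /\ eqV x (opair y z)).
  { intros Hx; sem. }
  split.
  - intros [Hx H]; apply S in H; [|eauto].
    destruct H as [y [_ [Hy [z [_ [Hz H]]]]]]; exists y, z; auto.
  - intros [y [z [Hy [Hz H]]]].
    assert (HyM : inV y M) by eauto. assert (HzM : inV z M) by eauto.
    assert (HxM : inV x M) by (rewrite H; auto using M_opair).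
    split; [|apply S; eauto 10].
    assert (In_u : forall v, inV v (upair y z) -> inV v (unionV (upair a b))).
    { intros v Hv; apply inV_unionV; apply inV_upair in Hv; destruct Hv as [E|E];
        [exists a | exists b]; rewrite E, inV_upair; split; trivial; [left|right]; reflexivity. }
    apply Ku; split; trivial; intros v Hv; rewrite H in Hv; apply inV_upair in Hv.
    apply Kw; destruct Hv as [E|E].
    + split; [rewrite E; auto using M_upair|]; intros t Ht; apply In_u.
      rewrite E in Ht; apply inV_upair in Ht; apply inV_upair; tauto.
    + split; [rewrite E; auto using M_upair|]; intros t Ht; apply In_u.
      rewrite E in Ht; exact Ht.
Qed.

Definition inductive_in (u : V) : Prop :=
  (exists x, inV x M /\ inV x u /\ eqV x emptyV) /\
  (forall x, inV x M -> inV x u -> exists y, inV y M /\ inV y u /\ eqV y (succV x)).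

(** The axiom as [M] reads it: [w] is so far only the intersection of those inductive sets that
    belong to [M]. *)
Lemma dependent_choice_raw A R : inV A M -> inV R M ->
  (exists a, inV a A) ->
  (forall a, inV a A -> exists b, inV b A /\ inV (opair a b) R) ->
  exists w, inV w M /\
    (forall x, inV x M ->
       (inV x w <-> forall u, inV u M -> inductive_in u -> inV x u)) /\
    exists f, inV f M /\
      ((forall x, inV x M -> inV x f -> exists n, inV n M /\ exists a, inV a M /\
          inV n w /\ inV a A /\ eqV x (opair n a)) /\
       (forall n, inV n M -> inV n w -> exists a, inV a M /\
          forall b, inV b M -> (inV (opair n b) f <-> eqV b a))) /\
      forall n, inV n M -> inV n w -> exists n', inV n' M /\ exists a, inV a M /\
        exists b, inV b M /\ eqV n' (succV n) /\ inV (opair n a) f /\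
          inV (opair n' b) f /\ inV (opair a b) R.
Proof.
  intros HA HR [a Ha] Hser.
  assert (Hax : satisfies M DependentChoice) by (apply Mfrag; cbn; auto).
  specialize (Hax (params []) (params_M [] (Forall_nil _))).
  assert (S : sat M (params []) DependentChoice <->
    forall A, inV A M -> forall R, inV R M ->
    (exists a, inV a M /\ inV a A) /\
    (forall a, inV a M -> inV a A -> exists b, inV b M /\ inV b A /\ inV (opair a b) R) ->
    exists w, inV w M /\
    (forall x, inV x M ->
       (inV x w <-> forall u, inV u M -> inductive_in u -> inV x u)) /\
    exists f, inV f M /\
      ((forall x, inV x M -> inV x f -> exists n, inV n M /\ exists a, inV a M /\
          inV n w /\ inV a A /\ eqV x (opair n a)) /\
       (forall n, inV n M -> inV n w -> exists a, inV a M /\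
          forall b, inV b M -> (inV (opair n b) f <-> eqV b a))) /\
      forall n, inV n M -> inV n w -> exists n', inV n' M /\ exists a, inV a M /\
        exists b, inV b M /\ eqV n' (succV n) /\ inV (opair n a) f /\
          inV (opair n' b) f /\ inV (opair a b) R) by (unfold inductive_in; sem).
  pose proof (proj1 S Hax A HA R HR) as K.
  apply K; split; [eauto|].
  intros x Hx HxA; destruct (Hser x HxA) as [b [Hb Hab]]; eauto.
Qed.

Lemma numV_inductive u n : inductive_in u -> inV (numV n) u.
Proof.
  intros [[x [_ [Hx E]]] Hs]; induction n as [|n IH]; cbn.
  - rewrite <- E; exact Hx.
  - destruct (Hs (numV n) (M_numV n) IH) as [y [_ [Hy E']]]; rewrite <- E'; exact Hy.
Qed.

(* An element of w that is not a numeral and is minimal so could be removed from w. *)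
Lemma omega_in_M w : inV w M ->
  (forall x, inV x M -> (inV x w <-> forall u, inV u M -> inductive_in u -> inV x u)) ->
  eqV w omegaV.
Proof.
  intros Hw K.
  assert (Hnum : forall n, inV (numV n) w).
  { intros n; apply K; [apply M_numV|]; intros u _ Hu; apply numV_inductive, Hu. }
  apply eqV_ext; intros x; rewrite inV_omegaV; split; [|intros [n ->]; apply Hnum].
  induction (inV_wf x) as [x _ IH]; intros Hx; apply NNPP; intros Hn.
  assert (HxM : inV x M) by eauto.
  destruct (M_separation phi_neq [x] w) as [w' [Hw' Kw]]; [cbn; tauto | auto | trivial |].
  assert (S : forall y, inV y M -> sat M (upd (params [x]) 0 y) phi_neq <-> ~ eqV y x).
  { intros y Hy; sem. }
  assert (Hin : inV x w').
  { apply K; trivial; split.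
    - exists emptyV; split; [exact M_emptyV | split; [|reflexivity]].
      apply Kw; split; [apply (Hnum 0) | apply S; [exact M_emptyV|]].
      intros E; apply Hn; exists 0; symmetry; exact E.
    - intros y Hy Hyw; apply Kw in Hyw; destruct Hyw as [Hyw _].
      exists (succV y); split; [auto using M_succV | split; [|reflexivity]].
      apply Kw; split; [|apply S; [auto using M_succV|]].
      + apply K; [auto using M_succV|]; intros u Hu Hind.
        destruct (proj2 Hind y Hy) as [z [_ [Hz E]]]; [apply K; auto|].
        rewrite <- E; exact Hz.
      + intros E; destruct (IH y) as [n Hnn]; trivial.
        * rewrite <- E, inV_succV; right; reflexivity.
        * apply Hn; exists (1 + n); rewrite <- E, Hnn; reflexivity. }
  apply Kw in Hin; destruct Hin as [_ Hin]; apply S in Hin; trivial; apply Hin; reflexivity.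
Qed.

(** [DependentChoice] asserts the existence of omega along with the sequence, so its instance for a
    one-point relation yields omega. *)
Lemma M_omegaV : inV omegaV M.
Proof.
  destruct (dependent_choice_raw (upair emptyV emptyV)
    (upair (opair emptyV emptyV) (opair emptyV emptyV))) as [w [Hw [K _]]].
  - auto using M_upair, M_emptyV.
  - auto using M_upair, M_opair, M_emptyV.
  - exists emptyV; apply inV_upair; left; reflexivity.
  - intros a Ha; exists emptyV; rewrite !inV_upair; split; [left; reflexivity|].
    left; apply inV_upair in Ha; apply opair_eq; [tauto | reflexivity].
  - rewrite <- (omega_in_M w Hw K); exact Hw.
Qed.

(** Since the omega of [M] is the true one, the internal choice sequence can be read as a function
    on [nat]. Its graph [f] is kept as well: being in [M], it can serve as a parameter of further
    Separation instances. *)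
Lemma M_dependent_choice A R : inV A M -> inV R M ->
  (exists a, inV a A) ->
  (forall a, inV a A -> exists b, inV b A /\ inV (opair a b) R) ->
  exists a : nat -> V, (forall i, inV (a i) A) /\
    (forall i, inV (opair (a i) (a (S i))) R) /\
    exists f, inV f M /\
      forall n b, inV (opair n b) f <-> exists i, eqV n (numV i) /\ eqV b (a i).
Proof.
  intros HA HR HA0 Hser.
  destruct (dependent_choice_raw A R HA HR HA0 Hser)
    as [w [Hw [Kw [f [Hf [[F1 F2] F3]]]]]].
  apply omega_in_M in Kw; trivial.
  assert (Hn : forall n, inV (numV n) w) by (intros n; rewrite Kw; apply numV_omegaV).
  assert (F2' : forall n, {a | inV a M /\
    forall b, inV b M -> (inV (opair (numV n) b) f <-> eqV b a)}).
  { intros n; apply constructive_indefinite_description, F2; auto using M_numV. }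
  set (a := fun n => proj1_sig (F2' n)).
  assert (HaM : forall n, inV (a n) M) by (intros n; apply (proj2_sig (F2' n))).
  assert (Ha : forall n b, inV b M -> (inV (opair (numV n) b) f <-> eqV b (a n)))
    by (intros n; apply (proj2_sig (F2' n))).
  assert (Hin : forall n, inV (opair (numV n) (a n)) f) by (intros n; apply Ha; [auto|reflexivity]).
  exists a; split; [|split; [|exists f; split; [trivial|]]].
  - intros n; destruct (F1 _ (M_opair _ _ (M_numV n) (HaM n)) (Hin n))
      as [m [_ [b [_ [_ [Hb E]]]]]].
    apply opair_inj in E; destruct E as [_ E]; rewrite E; exact Hb.
  - intros n; destruct (F3 (numV n) (M_numV n) (Hn n))
      as [n' [_ [x [Hx [y [Hy [E [H1 [H2 H3]]]]]]]]].
    rewrite E in H2; apply Ha in H1; trivial; apply (Ha (S n)) in H2; trivial.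
    rewrite <- H1, <- H2; exact H3.
  - intros n b; split.
    + intros H; destruct (M_opair_inv M Mtrans n b) as [HnM HbM]; [eauto|].
      destruct (F1 _ (Mtrans _ _ H Hf) H) as [m [_ [c [_ [Hm [_ E]]]]]].
      rewrite Kw in Hm; apply opair_inj in E; destruct Hm as [i Hi], E as [E _].
      cbn in Hi; exists i; split; [now rewrite E|].
      apply Ha; trivial; rewrite <- Hi, <- E; exact H.
    + intros [i [-> ->]]; apply Hin.
Qed.

(** The iterated unions of {t} are collected by Replacement along omega; their union is transitive
    because an element of a member of one iterate lies in the next. *)
Lemma M_transitive_closure t : inV t M ->
  exists T, inV T M /\ inV t T /\ transitiveV T.
Proof.
  intros Ht.
  set (t0 := upair t t).
  set (u := fun n => Nat.iter n unionV t0).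
  assert (HuM : forall n, inV (u n) M).
  { induction n; cbn; [apply M_upair | apply M_unionV]; trivial. }
  assert (S : forall n x, inV n M -> inV x M ->
    sat M (upd (upd (params [t0]) 0 n) 1 x) phi_tc <->
    exists g, inV g M /\ inV (opair n x) g /\ forall k, inV k M -> forall v, inV v M ->
      inV (opair k v) g -> (eqV k emptyV /\ eqV v t0) \/
      exists k', inV k' M /\ exists v', inV v' M /\ inV (opair k' v') g /\
        eqV k (succV k') /\ eqV v (unionV v')).
  { assert (inV t0 M) by (apply M_upair; trivial). intros n x Hn Hx; sem. }
  assert (U : forall n x, inV x M ->
    sat M (upd (upd (params [t0]) 0 (numV n)) 1 x) phi_tc <-> eqV x (u n)).
  { intros n x Hx; rewrite S; auto using M_numV; split.
    (* The attempt [g] is not assumed to be a function. Tracing the justification of a pair back to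
       0 already determines its second coordinate. *)
    - intros [g [Hg [Hin K]]]; revert x Hx Hin; induction n as [|n IH]; intros x Hx Hin.
      + destruct (K _ (M_numV 0) x Hx Hin) as [[_ E]|[k [_ [v [_ [_ [E _]]]]]]]; [exact E|].
        exfalso; apply (inV_emptyV k); cbn in E; rewrite E, inV_succV; right; reflexivity.
      + destruct (K _ (M_numV (1 + n)) x Hx Hin) as [[E _]|[k [Hk [v [Hv [H1 [H2 H3]]]]]]].
        * exfalso; apply (inV_emptyV (numV n)); rewrite <- E; cbn.
          rewrite inV_succV; right; reflexivity.
        * assert (E : eqV k (numV n)).
          { assert (Hk' : inV k (numV (1 + n))).
            { rewrite H2, inV_succV; right; reflexivity. }
            apply inV_numV in Hk'; destruct Hk' as [i [_ Ei]].
            rewrite Ei in H2; apply (numV_inj (1 + n) (1 + i)) in H2.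
            rewrite Ei; replace i with n by lia; reflexivity. }
          rewrite E in H1; apply IH in H1; trivial; rewrite H3, H1; reflexivity.
    - intros E.
      assert (Hg : exists g, inV g M /\ forall z, inV z g <-> exists i, i <= n /\
        eqV z (opair (numV i) (u i))).
      { clear E; induction n as [|n [g [Hg Kg]]].
        - exists (upair (opair (numV 0) (u 0)) (opair (numV 0) (u 0))); split.
          { auto using M_upair, M_opair, M_numV. }
          intros z; rewrite inV_upair; split; [intros Hz; exists 0; split; [lia|tauto]|].
          intros [i [Hi Hz]]; replace i with 0 in Hz by lia; auto.
        - exists (adjoin g (opair (numV (1 + n)) (u (1 + n)))); split.
          { auto using M_adjoin, M_opair, M_numV. }
          intros z; rewrite inV_adjoin, Kg; split.
          + intros [[i [Hi Hz]]|Hz]; [exists i | exists (1 + n)]; (split; [lia | exact Hz]).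
          + intros [i [Hi Hz]]; destruct (Nat.eq_dec i (1 + n)) as [->|]; auto.
            left; exists i; split; [lia | exact Hz]. }
      destruct Hg as [g [Hg Kg]]; exists g; split; trivial; split.
      { apply Kg; exists n; split; [lia | now rewrite E]. }
      intros k _ v _ Hkv; apply Kg in Hkv; destruct Hkv as [[|i] [Hi Hkv]];
        apply opair_inj in Hkv; [left; exact Hkv | right].
      exists (numV i); split; [apply M_numV|]; exists (u i); split; [apply HuM|].
      split; [|exact Hkv]; apply Kg; exists i; split; [lia | reflexivity]. }
  destruct (replacement M Mtrans phi_tc [t0] omegaV) as [c [Hc Kc]]; try reflexivity.
  - apply Mfrag; cbn; tauto.
  - exact M_emptyV.
  - constructor; [apply M_upair; trivial | constructor].
  - exact M_omegaV.
  - intros x [n Hn]; cbn in Hn; exists (u n); split; [apply HuM|]; intros y Hy.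
    rewrite <- (U n y Hy); apply sat_ext; intros v _; unfold upd.
    destruct (Nat.eqb v 1); [reflexivity|]; destruct (Nat.eqb v 0); [exact Hn | reflexivity].
  - assert (K : forall y, inV y c <-> exists n, eqV y (u n)).
    { intros y; rewrite Kc; split.
      - intros [Hy [x [[n Hn] Hs]]]; cbn in Hn; exists n; apply (U n y Hy).
        refine (proj1 (sat_ext _ _ _ _ _) Hs); intros v _; unfold upd.
        destruct (Nat.eqb v 1); [reflexivity|]; destruct (Nat.eqb v 0); [exact Hn|reflexivity].
      - intros [n Hn]; assert (Hy : inV y M) by (rewrite Hn; apply HuM); split; trivial.
        exists (numV n); split; [apply numV_omegaV | apply U; trivial]. }
    exists (unionV c); split; [auto using M_unionV | split].
    + apply inV_unionV; exists (u 0); split; [apply K; exists 0; reflexivity|].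
      cbn; apply inV_upair; left; reflexivity.
    + intros x y Hxy Hy; apply inV_unionV in Hy; destruct Hy as [v [Hv Hy]].
      apply K in Hv; destruct Hv as [n Hn]; rewrite Hn in Hy.
      apply inV_unionV; exists (u (1 + n)); split; [apply K; exists (1 + n); reflexivity|].
      cbn; apply inV_unionV; eauto.
Qed.

(** * Forcing *)

Variables P r : V.
Hypothesis HPr : inV (opair P r) M.
Hypothesis Hforc : forcing_notion P r.

Lemma P_M : inV P M.
Proof. exact (proj1 (M_opair_inv M Mtrans P r HPr)). Qed.
Lemma r_M : inV r M.
Proof. exact (proj2 (M_opair_inv M Mtrans P r HPr)). Qed.
Lemma P_elt_M p : inV p P -> inV p M.
Proof. intros H; exact (Mtrans _ _ H P_M). Qed.
Lemma le_P p q : leV r p q -> inV p P /\ inV q P.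
Proof.
  intros H; destruct Hforc as [_ [Hr _]]; destruct (Hr _ H) as [p' [q' [Hp [Hq E]]]].
  apply opair_inj in E; destruct E as [E1 E2]; rewrite E1, E2; auto.
Qed.
Lemma le_refl p : inV p P -> leV r p p.
Proof. apply Hforc. Qed.
Lemma le_trans p q s : leV r p q -> leV r q s -> leV r p s.
Proof. apply Hforc. Qed.
Lemma le_M p q : leV r p q -> inV p M /\ inV q M.
Proof. intros H; apply le_P in H; split; apply P_elt_M; tauto. Qed.
Lemma pair_in_M x y t : inV (opair x y) t -> inV t M -> inV x M /\ inV y M.
Proof. intros H Ht; apply (M_opair_inv M Mtrans); eauto. Qed.
Lemma tri_in_M x y z t : inV (opair x (opair y z)) t -> inV t M ->
  inV x M /\ inV y M /\ inV z M.
Proof.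
  intros H Ht; destruct (pair_in_M _ _ _ H Ht) as [H1 H2]; split; trivial.
  apply (M_opair_inv M Mtrans), H2.
Qed.

(** The conditions that are in [Q] or have no extension in [Q] form a dense set of [M]. *)
Lemma generic_decides G Q : generic M P r G -> inV Q M ->
  (exists g, inV g G /\ inV g Q) \/
  (exists g, inV g G /\ forall t, leV r t g -> ~ inV t Q).
Proof.
  intros [HG Hgen] HQ; pose proof r_M as HrM.
  destruct (M_separation phi_decide [r; Q] P) as [D [HD KD]];
    [cbn; tauto | auto | exact P_M |].
  assert (S : forall q, inV q M -> sat M (upd (params [r; Q]) 0 q) phi_decide <->
    inV q Q \/ forall t, inV t M -> inV (opair t q) r -> ~ inV t Q).
  { intros q Hq; sem. }
  destruct (Hgen D HD) as [g [HgG HgD]].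
  - split; [intros q Hq; apply KD, Hq|].
    intros p Hp.
    destruct (classic (exists q, leV r q p /\ inV q Q)) as [[q [Hq HqQ]]|H].
    + assert (HqP : inV q P) by (eapply proj1, le_P, Hq).
      exists q; split; trivial; apply KD; split; trivial; apply S; auto using P_elt_M.
    + exists p; split; [|apply le_refl, Hp]; apply KD; split; trivial.
      apply S; [auto using P_elt_M|]; right; intros t _ Ht HtQ; apply H; exists t; auto.
  - apply KD in HgD; destruct HgD as [HgP HgD]; apply S in HgD; [|auto using P_elt_M].
    destruct HgD as [HgD|HgD]; [left; eauto | right].
    exists g; split; trivial; intros t Ht; apply HgD; trivial; apply (le_M t g), Ht.
Qed.

(* The recursive clause for "p forces that the name s equals x", for x in the ground model. *)
Definition clause (E p s x : V) : Prop :=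
  (forall u v q, inV (opair u v) s -> leV r q p -> leV r q v ->
     exists q' y, leV r q' q /\ inV y x /\ inV (opair q' (opair u y)) E) /\
  (forall y q, inV y x -> leV r q p ->
     exists q' u v, leV r q' q /\ leV r q' v /\ inV (opair u v) s /\
       inV (opair q' (opair u y)) E).

(** The clause uses [E] positively, and only at triples whose name is a first coordinate of a pair
    in [s] and whose set is in [x]. The restricted hypothesis is what allows passing to an [E']
    confined to a product of transitive sets. *)
Lemma clause_mono E E' p s x :
  (forall q u y, inV (opair q (opair u y)) E -> inV u (unionV (unionV s)) -> inV y x ->
     inV q P -> inV (opair q (opair u y)) E') ->
  clause E p s x -> clause E' p s x.
Proof.
  assert (Hs : forall u v, inV (opair u v) s -> inV u (unionV (unionV s))).
  { intros u v H; apply inV_unionV; exists (upair u u); split.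
    - apply inV_unionV; exists (opair u v); split; trivial; apply inV_upair; left; reflexivity.
    - apply inV_upair; left; reflexivity. }
  intros H [C1 C2]; split.
  - intros u v q Huv Hqp Hqv; destruct (C1 u v q Huv Hqp Hqv) as [q' [y [K1 [K2 K3]]]].
    exists q', y; repeat (split; trivial); apply H; trivial; [eauto | eapply proj1, le_P, K1].
  - intros y q Hy Hq; destruct (C2 y q Hy Hq) as [q' [u [v [K1 [K2 [K3 K4]]]]]].
    exists q', u, v; repeat (split; trivial); apply H; trivial; [eauto | eapply proj1, le_P, K1].
Qed.

Lemma clause_eq E p p' s s' x x' : eqV p p' -> eqV s s' -> eqV x x' ->
  clause E p s x -> clause E p' s' x'.
Proof.
  intros Hp Hs Hx [C1 C2]; split.
  - intros u v q; rewrite <- Hs, <- Hp; intros H1 H2 H3.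
    destruct (C1 u v q H1 H2 H3) as [q' [y Hy]]; exists q', y; rewrite <- Hx; exact Hy.
  - intros y q; rewrite <- Hx, <- Hp; intros H1 H2.
    destruct (C2 y q H1 H2) as [q' [u [v H]]]; exists q', u, v; rewrite <- Hs; exact H.
Qed.

Lemma clause_le E p p' s x : leV r p' p -> clause E p s x -> clause E p' s x.
Proof.
  intros Hp [C1 C2]; split; intros; [eapply C1 | eapply C2]; eauto using le_trans.
Qed.

(* E is the union of all sets of triples each of whose members satisfies the clause. *)
Lemma forcing_relation_exists T W : inV T M -> inV W M -> transitiveV T -> transitiveV W ->
  exists E, inV E M /\
    (forall p s x, inV (opair p (opair s x)) E -> inV p P /\ inV s T /\ inV x W) /\
    (forall p s x, inV p P -> inV s T -> inV x W ->
       (inV (opair p (opair s x)) E <-> clause E p s x)).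
Proof.
  intros HT HW Ttr Wtr; pose proof r_M as HrM.
  set (B := prodV P (prodV T W)).
  assert (HB : inV B M) by (repeat apply M_prodV; trivial; exact P_M).
  destruct (M_separation phi_force [r] B) as [E [HE KE]]; [cbn; tauto | auto | trivial |].
  assert (S : forall b, inV b M -> sat M (upd (params [r]) 0 b) phi_force <->
    exists F, inV F M /\ inV b F /\ forall p, inV p M -> forall s, inV s M -> forall x, inV x M ->
      inV (opair p (opair s x)) F ->
      (forall u, inV u M -> forall v, inV v M -> forall q, inV q M ->
         inV (opair u v) s -> inV (opair q p) r -> inV (opair q v) r ->
         exists q', inV q' M /\ exists y, inV y M /\ inV (opair q' q) r /\ inV y x /\
           inV (opair q' (opair u y)) F) /\
      (forall y, inV y M -> forall q, inV q M -> inV y x -> inV (opair q p) r ->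
         exists q', inV q' M /\ exists u, inV u M /\ exists v, inV v M /\
           inV (opair q' q) r /\ inV (opair q' v) r /\ inV (opair u v) s /\
           inV (opair q' (opair u y)) F)).
  { intros b Hb; sem. }
  assert (S' : forall p s x, inV p M -> inV s M -> inV x M ->
    sat M (upd (params [r]) 0 (opair p (opair s x))) phi_force <->
    exists F, inV F M /\ inV (opair p (opair s x)) F /\
      forall p s x, inV (opair p (opair s x)) F -> clause F p s x).
  { intros p s x Hp Hs Hx; rewrite S by auto using M_opair; split;
      intros [F [HF [Hin K]]]; exists F; split; trivial; split; trivial.
    - intros p' s' x' Hin'; destruct (tri_in_M _ _ _ _ Hin' HF) as [Hp' [Hs' Hx']].
      destruct (K p' Hp' s' Hs' x' Hx' Hin') as [K1 K2]; split.
      + intros u v q Huv Hqp Hqv; destruct (pair_in_M _ _ _ Huv Hs') as [Hu Hv].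
        destruct (K1 u Hu v Hv q (proj1 (le_M _ _ Hqp)) Huv Hqp Hqv)
          as [q' [_ [y [_ H]]]]; eauto.
      + intros y q Hy Hq.
        destruct (K2 y (Mtrans _ _ Hy Hx') q (proj1 (le_M _ _ Hq)) Hy Hq)
          as [q' [_ [u [_ [v [_ H]]]]]]; eauto.
    - intros p' Hp' s' Hs' x' Hx' Hin'; destruct (K p' s' x' Hin') as [K1 K2]; split.
      + intros u Hu v Hv q Hq Huv Hqp Hqv; destruct (K1 u v q Huv Hqp Hqv)
          as [q' [y [H1 [H2 H3]]]].
        exists q'; split; [apply (le_M _ _ H1)|]; exists y; split; [eauto|auto].
      + intros y _ q _ Hy Hq; destruct (K2 y q Hy Hq) as [q' [u [v [H1 [H2 [H3 H4]]]]]].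
        destruct (pair_in_M _ _ _ H3 Hs') as [Hu Hv].
        exists q'; split; [apply (le_M _ _ H1)|]; exists u; split; [trivial|].
        exists v; auto. }
  assert (EB : forall p s x, inV (opair p (opair s x)) E -> inV p P /\ inV s T /\ inV x W).
  { intros p s x H; apply KE in H; destruct H as [H _]; unfold B in H.
    now rewrite !opair_prodV in H. }
  assert (KE' : forall p s x, inV (opair p (opair s x)) E <->
    (inV p P /\ inV s T /\ inV x W) /\ exists F, inV F M /\ inV (opair p (opair s x)) F /\
      forall p s x, inV (opair p (opair s x)) F -> clause F p s x).
  { intros p s x; rewrite KE; unfold B; rewrite !opair_prodV; split.
    - intros [H K]; split; trivial; apply S' in K; trivial;
        [apply P_elt_M | apply (fun H => Mtrans _ _ H HT) | apply (fun H => Mtrans _ _ H HW)]; tauto.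
    - intros [H K]; split; trivial; apply S'; trivial;
        [apply P_elt_M | apply (fun H => Mtrans _ _ H HT) | apply (fun H => Mtrans _ _ H HW)]; tauto. }
  assert (Tun : forall s u, inV s T -> inV u (unionV (unionV s)) -> inV u T).
  { intros s u Hs Hu; apply inV_unionV in Hu; destruct Hu as [v [Hv Hu]].
    apply inV_unionV in Hv; destruct Hv as [w [Hw Hv]]; eauto. }
  (* The union of sets satisfying the clause satisfies it too, by monotonicity; transitivity of [T]
     and [W] keeps the required triples inside [B]. *)
  assert (Epost : forall p s x, inV (opair p (opair s x)) E -> clause E p s x).
  { intros p s x H; apply KE' in H; destruct H as [[Hp [Hs Hx]] [F [HF [Hin K]]]].
    apply (clause_mono F); [|auto]; intros q u y Hq Hu Hy HqP; apply KE'; split.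
    - split; trivial; split; [eauto | apply (Wtr y x); trivial].
    - exists F; auto. }
  exists E; split; [trivial | split; [trivial|]]; intros p s x Hp Hs Hx; split; [apply Epost|].
  intros Hcl; apply KE'; split; [auto|].
  (* The Knaster-Tarski argument: a triple satisfying the clause for [E] can be adjoined without
     leaving the family whose union is [E], so it was in [E] already. *)
  exists (adjoin E (opair p (opair s x))); split; [|split].
  - apply M_adjoin; trivial; repeat apply M_opair; eauto using P_elt_M.
  - apply inV_adjoin; right; reflexivity.
  - intros p' s' x' H; apply (clause_mono E).
    { intros q u y Hq _ _ _; apply inV_adjoin; auto. }
    apply inV_adjoin in H; destruct H as [H|H]; [auto|].
    apply opair_inj in H; destruct H as [E1 H]; apply opair_inj in H; destruct H as [E2 E3].
    apply (clause_eq E p p' s s' x x'); trivial; symmetry; trivial.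
Qed.

Lemma generic_common G p q : generic M P r G -> inV p G -> inV q G ->
  exists s, inV s G /\ leV r s p /\ leV r s q.
Proof. intros [HG _]; apply HG. Qed.

(** Induction on [x] with the name arbitrary; each step applies [generic_decides] to a set of
    conditions definable from [E]. Only the fixed-point equation for [E] enters. *)
Lemma forcing_truth T W E G : inV T M -> inV W M -> transitiveV T -> transitiveV W ->
  inV E M ->
  (forall p s x, inV p P -> inV s T -> inV x W ->
     (inV (opair p (opair s x)) E <-> clause E p s x)) ->
  generic M P r G ->
  forall x, inV x W -> forall s, inV s T ->
    ((exists p, inV p G /\ inV (opair p (opair s x)) E) <-> eqV (val G s) x).
Proof.
  intros HT HW Ttr Wtr HE KE HG x; pose proof r_M as HrM.
  assert (GP : forall p, inV p G -> inV p P) by apply HG.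
  assert (Gup : forall p q, inV p G -> leV r p q -> inV q G).
  { intros p q Hp Hq; destruct HG as [HG _]; eapply HG; eauto; apply (le_P p q Hq). }
  assert (Emono : forall p q s x, inV s T -> inV x W -> leV r q p ->
    inV (opair p (opair s x)) E -> inV (opair q (opair s x)) E).
  { intros p q s y Hs Hy Hq H; destruct (le_P _ _ Hq) as [HqP HpP].
    apply KE; trivial; apply KE in H; trivial; eauto using clause_le. }
  assert (Tname : forall s u v, inV s T -> inV (opair u v) s -> inV u T).
  { intros s u v Hs H; apply (Ttr u (upair u u)); [apply inV_upair; left; reflexivity|].
    apply (Ttr (upair u u) (opair u v)); [apply inV_upair; left; reflexivity|]; eauto. }
  induction (inV_wf x) as [x _ IH]; intros Hx s Hs.
  assert (HxM : inV x M) by eauto. assert (HsM : inV s M) by eauto.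
  assert (IH' : forall y, inV y x -> forall s, inV s T ->
    ((exists p, inV p G /\ inV (opair p (opair s y)) E) <-> eqV (val G s) y))
    by (intros y Hy; apply IH; eauto).
  clear IH; split.
  - intros [p [Hp Hpsx]]; apply KE in Hpsx; auto; destruct Hpsx as [C1 C2].
    apply eqV_ext; intros z; split.
    + intros Hz; apply inV_val in Hz; destruct Hz as [u [v [Hv [Huv Hz]]]].
      assert (HuT : inV u T) by eauto. assert (HuM : inV u M) by eauto.
      (* [Q] holds the conditions that force [u] to equal some member of [x]. The first half of the
         clause makes it dense below any common extension of [p] and [v], so no member of [G] can
         exclude it. *)
      destruct (M_separation phi_member [E; u; x] P) as [Q [HQ KQ]];
        [cbn; tauto | auto | exact P_M |].
      assert (SQ : forall q, inV q M -> sat M (upd (params [E; u; x]) 0 q) phi_member <->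
        exists y, inV y M /\ inV y x /\ inV (opair q (opair u y)) E) by (intros q Hq; sem).
      destruct (generic_decides G Q HG HQ) as [[g [Hg HgQ]]|[g [Hg HgQ]]].
      * apply KQ in HgQ; destruct HgQ as [HgP HgQ]; apply SQ in HgQ; [|auto using P_elt_M].
        destruct HgQ as [y [_ [Hy HgE]]].
        rewrite Hz, (proj1 (IH' y Hy u HuT)); eauto.
      * exfalso; destruct (generic_common G p v HG Hp Hv) as [q [Hq [Hqp Hqv]]].
        destruct (generic_common G q g HG Hq Hg) as [t [Ht [Htq Htg]]].
        destruct (C1 u v t Huv) as [t' [y [Ht' [Hy HtE]]]]; eauto using le_trans.
        apply (HgQ t'); [eauto using le_trans|].
        assert (Ht'P : inV t' P) by apply (le_P _ _ Ht').
        apply KQ; split; trivial; apply SQ; [auto using P_elt_M|]; exists y; eauto.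
    + intros Hz; assert (HzM : inV z M) by eauto.
      (* Dually, these conditions force [z] to be the value of some name that they put into [s]; the
         second half of the clause applies. *)
      destruct (M_separation phi_attain [r; E; s; z] P) as [Q [HQ KQ]];
        [cbn; tauto | auto | exact P_M |].
      assert (SQ : forall q, inV q M -> sat M (upd (params [r; E; s; z]) 0 q) phi_attain <->
        exists u, inV u M /\ exists v, inV v M /\ inV (opair u v) s /\ inV (opair q v) r /\
          inV (opair q (opair u z)) E) by (intros q Hq; sem).
      destruct (generic_decides G Q HG HQ) as [[g [Hg HgQ]]|[g [Hg HgQ]]].
      * apply KQ in HgQ; destruct HgQ as [HgP HgQ]; apply SQ in HgQ; [|auto using P_elt_M].
        destruct HgQ as [u [_ [v [_ [Huv [Hgv HgE]]]]]].
        apply inV_val; exists u, v; split; [eauto | split; trivial].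
        symmetry; apply IH'; eauto.
      * exfalso; destruct (generic_common G p g HG Hp Hg) as [t [Ht [Htp Htg]]].
        destruct (C2 z t Hz Htp) as [t' [u [v [H1 [H2 [H3 H4]]]]]].
        apply (HgQ t'); [eauto using le_trans|].
        destruct (pair_in_M _ _ _ H3 HsM) as [HuM HvM].
        assert (Ht'P : inV t' P) by apply (le_P _ _ H1).
        apply KQ; split; trivial; apply SQ; [auto using P_elt_M|].
        exists u; split; trivial; exists v; auto.
  - intros Hval.
    (* [Q] holds the conditions that witness a failure of one half of the clause for good. If [G]
       meets [Q], the induction hypothesis contradicts the value of [s]. *)
    destruct (M_separation phi_fail [r; E; s; x] P) as [Q [HQ KQ]];
      [cbn; tauto | auto | exact P_M |].
    assert (SQ : forall q, inV q M -> sat M (upd (params [r; E; s; x]) 0 q) phi_fail <->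
      (exists u, inV u M /\ exists v, inV v M /\ inV (opair u v) s /\ inV (opair q v) r /\
         forall t, inV t M -> forall y, inV y M -> inV (opair t q) r -> inV y x ->
           ~ inV (opair t (opair u y)) E) \/
      (exists y, inV y M /\ inV y x /\ forall t, inV t M -> forall u, inV u M ->
         forall v, inV v M -> inV (opair t q) r -> inV (opair t v) r ->
           inV (opair u v) s -> ~ inV (opair t (opair u y)) E)) by (intros q Hq; sem).
    destruct (generic_decides G Q HG HQ) as [[g [Hg HgQ]]|[g [Hg HgQ]]].
    + exfalso; apply KQ in HgQ; destruct HgQ as [HgP HgQ]; apply SQ in HgQ; [|auto using P_elt_M].
      destruct HgQ as [[u [_ [v [_ [Huv [Hgv HgQ]]]]]]|[y [_ [Hy HgQ]]]].
      * assert (Hin : inV (val G u) x).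
        { rewrite <- Hval; apply inV_val; exists u, v; split; [eauto | split; [trivial|reflexivity]]. }
        destruct (proj2 (IH' _ Hin u (Tname s u v Hs Huv))) as [p [Hp HpE]]; [reflexivity|].
        destruct (generic_common G p g HG Hp Hg) as [t [Ht [Htp Htg]]].
        apply (HgQ t (P_elt_M _ (GP _ Ht)) _ (Mtrans _ _ Hin HxM) Htg Hin).
        apply (Emono p); eauto.
      * assert (Hin : inV y (val G s)) by (rewrite Hval; exact Hy).
        apply inV_val in Hin; destruct Hin as [u [v [Hv [Huv Hyu]]]].
        destruct (proj2 (IH' y Hy u (Tname s u v Hs Huv))) as [p [Hp HpE]];
          [symmetry; exact Hyu|].
        destruct (generic_common G p g HG Hp Hg) as [t [Ht [Htp Htg]]].
        destruct (generic_common G t v HG Ht Hv) as [t' [Ht' [Htt' Htv]]].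
        destruct (pair_in_M _ _ _ Huv HsM) as [HuM HvM].
        apply (HgQ t' (P_elt_M _ (GP _ Ht')) u HuM v HvM (le_trans _ _ _ Htt' Htg) Htv Huv).
        apply (Emono p); eauto using le_trans.
    (* That no extension of [g] witnesses a failure is, read classically, the clause at [g]. *)
    + exists g; split; trivial; apply KE; auto; split.
      * intros u v q Huv Hqg Hqv; apply NNPP; intros Hn; apply (HgQ q Hqg).
        destruct (pair_in_M _ _ _ Huv HsM) as [HuM HvM].
        destruct (le_P _ _ Hqg) as [HqP _].
        apply KQ; split; trivial; apply SQ; [auto using P_elt_M|]; left.
        exists u; split; trivial; exists v; repeat (split; trivial).
        intros t _ y _ Htq Hy Hin; apply Hn; exists t, y; auto.
      * intros y q Hy Hqg; apply NNPP; intros Hn; apply (HgQ q Hqg).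
        destruct (le_P _ _ Hqg) as [HqP _].
        apply KQ; split; trivial; apply SQ; [auto using P_elt_M|]; right.
        exists y; split; [eauto|]; split; trivial.
        intros t _ u _ v _ Htq Htv Huv Hin; apply Hn; exists t, u, v; auto.
Qed.

(** * Bounds for the reals of the extension *)

(* q forces that the k-th value of every real handled so far is below m. *)
Definition bounds (C q : V) (k m : nat) : Prop :=
  inV (opair q (opair (numV k) (numV m))) C.

(** All that the fusion uses of the forcing relation. Bounds can be raised, so finitely many of them
    have a common one; density concerns a single value [k], as no condition need bound all values at
    once. *)
Record bound_system (C : V) : Prop := {
  bs_M : inV C M;
  bs_le : forall p q k m, leV r q p -> bounds C p k m -> bounds C q k m;
  bs_up : forall q k m m', m <= m' -> bounds C q k m -> bounds C q k m';
  bs_dense : forall q k, inV q P -> exists q' m, leV r q' q /\ bounds C q' k m }.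

(** Quantified over all generic filters, since names are handled before the filter is known; it says
    nothing about filters at which the value of [t] is not a real. *)
Definition handles (C t : V) : Prop :=
  forall G x, generic M P r G -> eqV (realV x) (val G t) ->
  forall q k m, inV q G -> bounds C q k m -> x k < m.

(** A transitive range for the ground-model sets in the forcing relation: the double power set of
    omega, which is transitive because numerals are subsets of omega. *)
Lemma M_opair_numV_cover : exists W, inV W M /\ transitiveV W /\
  forall k m, inV (opair (numV k) (numV m)) W.
Proof.
  destruct (M_powerset omegaV M_omegaV) as [w [Hw Kw]].
  destruct (M_powerset w Hw) as [W [HW KW]].
  assert (Htr : forall n x, inV x (numV n) -> exists i, eqV x (numV i)).
  { intros n x Hx; apply inV_numV in Hx; destruct Hx as [i [_ Hi]]; eauto. }
  exists W; split; [trivial | split].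
  - intros x y Hxy Hy; apply KW in Hy; destruct Hy as [HyM Hy]; apply KW; split; [eauto|].
    intros z Hz; apply Hy, Kw in Hxy; destruct Hxy as [_ Hxy].
    apply Hxy in Hz; destruct Hz as [n Hn]; cbn in Hn; apply Kw; split.
    + rewrite Hn; apply M_numV.
    + intros t Ht; rewrite Hn in Ht; apply Htr in Ht; exact Ht.
  - assert (K : forall k m, inV (upair (numV k) (numV m)) w).
    { intros k m; apply Kw; split; [auto using M_upair, M_numV|]; intros z Hz.
      apply inV_upair in Hz; destruct Hz as [Hz|Hz]; rewrite Hz; apply numV_omegaV. }
    intros k m; apply KW; split; [auto using M_opair, M_numV|]; intros z Hz.
    apply inV_upair in Hz; destruct Hz as [Hz|Hz]; rewrite Hz; apply K.
Qed.

(** [C'] keeps a triple (q, k, m) of [C] if [q] decides a k-th value below m, or if no extension of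
    [q] decides any k-th value. The second alternative gives density for an arbitrary [t], and
    cannot occur in a filter at which [t] evaluates to a real. *)
Lemma handle_name C t : bound_system C -> inV t M ->
  exists C', bound_system C' /\ handles C' t /\
    forall q k m, bounds C' q k m -> bounds C q k m.
Proof.
  intros HC Ht; pose proof r_M as HrM; pose proof M_omegaV as HoM.
  destruct (M_transitive_closure t Ht) as [T [HT [HtT Ttr]]].
  destruct M_opair_numV_cover as [W [HW [Wtr HWp]]].
  destruct (forcing_relation_exists T W HT HW Ttr Wtr) as [E [HE [EB KE]]].
  set (dec := fun q k m => exists u v, inV (opair u v) t /\ leV r q v /\
    inV (opair q (opair u (opair (numV k) (numV m)))) E).
  assert (HtT' : forall u v, inV (opair u v) t -> inV u T).
  { intros u v H; apply (Ttr u (upair u u)); [apply inV_upair; left; reflexivity|].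
    apply (Ttr (upair u u) (opair u v)); [apply inV_upair; left; reflexivity|]; eauto. }
  assert (dec_le : forall p q k m, leV r q p -> dec p k m -> dec q k m).
  { intros p q k m Hq [u [v [Huv [Hv H]]]]; exists u, v; split; [trivial | split; [eauto using le_trans|]].
    destruct (le_P _ _ Hq) as [HqP HpP]; apply KE; eauto.
    apply (clause_le _ p); trivial; apply KE; eauto. }
  destruct (M_separation phi_handle [t; r; E; omegaV] C) as [C' [HC' KC']];
    [cbn; tauto | auto | apply HC |].
  set (decM := fun q k m => exists u, inV u M /\ exists v, inV v M /\ exists w, inV w M /\
      inV (opair u v) t /\ inV (opair q v) r /\ eqV w (opair k m) /\ inV (opair q (opair u w)) E).
  assert (SC : forall c, inV c M -> sat M (upd (params [t; r; E; omegaV]) 0 c) phi_handle <->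
    exists q, inV q M /\ exists k, inV k M /\ exists m, inV m M /\ eqV c (opair q (opair k m)) /\
      ((exists m', inV m' M /\ inV m' m /\ decM q k m') \/
       (forall q', inV q' M -> forall m', inV m' M -> inV (opair q' q) r -> inV m' omegaV ->
          ~ decM q' k m'))) by (intros c Hc; unfold decM; sem).
  assert (decE : forall q k k' m m', eqV k (numV k') -> eqV m (numV m') ->
    decM q k m <-> dec q k' m').
  { intros q k k' m m' Hk Hm; split.
    - intros [u [_ [v [_ [w [_ [H1 [H2 [H3 H4]]]]]]]]]; exists u, v; split; [|split]; trivial.
      rewrite H3, Hk, Hm in H4; exact H4.
    - intros [u [v [H1 [H2 H3]]]]; destruct (pair_in_M _ _ _ H1 Ht) as [Hu Hv].
      exists u; split; trivial; exists v; split; trivial.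
      exists (opair (numV k') (numV m')); split; [auto using M_opair, M_numV|].
      split; [exact H1 | split; [exact H2 | split; [rewrite Hk, Hm; reflexivity | exact H3]]]. }
  assert (KB : forall q k m, bounds C' q k m <-> bounds C q k m /\
    ((exists j, j < m /\ dec q k j) \/ forall q' j, leV r q' q -> ~ dec q' k j)).
  { intros q k m; unfold bounds; rewrite KC'.
    split; intros [HqC H]; split; trivial;
      destruct (tri_in_M _ _ _ _ HqC (bs_M _ HC)) as [HqM [HkM HmM]].
    - apply SC in H; [|auto using M_opair].
      destruct H as [q0 [_ [k0 [_ [m0 [_ [E0 H]]]]]]].
      apply opair_inj in E0; destruct E0 as [E1 E0]; apply opair_inj in E0; destruct E0 as [E2 E3].
      destruct H as [[m' [_ [Hm' H]]]|H]; [left | right].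
      + rewrite <- E3 in Hm'; apply inV_numV in Hm'; destruct Hm' as [j [Hj Ej]].
        exists j; split; trivial.
        apply (decE q0 k0 k m' j) in H; [|symmetry; exact E2 | exact Ej].
        destruct H as [u [v [H1 [H2 H3]]]]; exists u, v; rewrite E1; auto.
      + intros q' j Hq'; destruct (le_M _ _ Hq') as [Hq'M _]; rewrite E1 in Hq'.
        intros K; apply (H q' Hq'M (numV j) (M_numV j) Hq' (numV_omegaV j)).
        apply (decE q' k0 k (numV j) j); [symmetry; exact E2 | reflexivity | exact K].
    - apply SC; [auto using M_opair|].
      exists q; split; trivial; exists (numV k); split; trivial.
      exists (numV m); split; trivial; split; [reflexivity|].
      destruct H as [[j [Hj H]]|H]; [left | right].
      + exists (numV j); split; [apply M_numV|]; split; [apply inV_numV_numV, Hj|].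
        apply (decE q (numV k) k (numV j) j); trivial; reflexivity.
      + intros q' _ m' _ Hq' [j Hj] K; cbn in Hj; apply (H q' j Hq').
        apply (decE q' (numV k) k m' j); trivial; reflexivity. }
  exists C'; split; [|split].
  - split; trivial.
    + intros p q k m Hq H; apply KB in H; destruct H as [H K]; apply KB.
      split; [eapply bs_le; eauto|].
      destruct K as [[j [Hj K]]|K]; [left; eauto | right; eauto using le_trans].
    + intros q k m m' Hm H; apply KB in H; destruct H as [H K]; apply KB.
      split; [eapply bs_up; eauto|].
      destruct K as [[j [Hj K]]|K]; [left; exists j; split; [lia | trivial] | auto].
    + intros q k Hq; destruct (bs_dense _ HC q k Hq) as [q1 [m1 [Hq1 H1]]].
      destruct (classic (exists q2 j, leV r q2 q1 /\ dec q2 k j)) as [[q2 [j [Hq2 Hj]]]|Hn].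
      (* [m1] serves the names handled before, and [S j] the value [j] just decided. *)
      * exists q2, (Nat.max m1 (S j)); split; [eauto using le_trans|].
        apply KB; split; [|left; exists j; split; [lia | trivial]].
        apply (bs_up _ HC q2 k m1); [lia|]; eapply bs_le; eauto.
      * exists q1, m1; split; trivial; apply KB; split; trivial; right.
        intros q' j Hq' Hd; apply Hn; eauto.
  - intros G x HG Hx q k m Hq H; apply KB in H; destruct H as [_ H].
    assert (truth := forcing_truth T W E G HT HW Ttr Wtr HE KE HG).
    destruct H as [[j [Hj [u [v [Huv [Hqv H]]]]]]|H].
    + assert (Hu : eqV (val G u) (opair (numV k) (numV j))) by (apply truth; eauto).
      assert (Hv : inV v G).
      { destruct HG as [[_ [_ [Gup _]]] _]; apply (Gup q); trivial; apply (le_P _ _ Hqv). }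
      assert (K : inV (opair (numV k) (numV j)) (realV x)).
      { rewrite Hx; apply inV_val; exists u, v; split; [trivial | split; trivial].
        symmetry; exact Hu. }
      apply opair_numV_realV in K; lia.
    (* The true value at [k] enters through a pair (u, v) with [v] in [G], and the truth lemma gives
       a condition of [G] forcing it. A common extension with [q] decides the value after all. *)
    + exfalso; assert (K : inV (opair (numV k) (numV (x k))) (val G t)).
      { rewrite <- Hx; apply opair_numV_realV; reflexivity. }
      apply inV_val in K; destruct K as [u [v [Hv [Huv K]]]].
      symmetry in K; apply truth in K; eauto; destruct K as [p [Hp K]].
      destruct (generic_common G p q HG Hp Hq) as [s [Hs [Hsp Hsq]]].
      destruct (generic_common G s v HG Hs Hv) as [s' [Hs' [Hs's Hs'v]]].
      apply (H s' (x k)); [eauto using le_trans|]; exists u, v; split; [|split]; trivial.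
      assert (Hs'p : leV r s' p) by eauto using le_trans.
      destruct (le_P _ _ Hs'p) as [Hs'P HpP]; apply KE; eauto.
      apply (clause_le _ p); trivial; apply KE; eauto.
  - intros q k m H; apply KB in H; tauto.
Qed.

(** The starting point: with no name handled, every triple is admissible. *)
Lemma trivial_bound_system : exists C, bound_system C.
Proof.
  exists (prodV P (prodV omegaV omegaV)); unfold bounds; split.
  - repeat apply M_prodV; auto using P_M, M_omegaV.
  - intros p q k m Hq; unfold bounds; rewrite !opair_prodV; destruct (le_P _ _ Hq); tauto.
  - intros q k m m' _; unfold bounds; rewrite !opair_prodV; intros [H _]; auto using numV_omegaV.
  - intros q k Hq; exists q, 0; split; [apply le_refl, Hq|].
    unfold bounds; rewrite !opair_prodV; auto using numV_omegaV.
Qed.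

(** * Fusion of the candidates by dependent choice in M *)

Definition partial_map (k : nat) (g : V) : Prop :=
  inV g M /\ subV g (prodV omegaV P) /\
  (forall n q, inV (opair n q) g -> inV n (numV k)) /\
  (forall n q q', inV (opair n q) g -> inV (opair n q') g -> eqV q q').

Lemma partial_map_empty k : partial_map k emptyV.
Proof.
  split; [exact M_emptyV|]; split; [|split]; [intros z H | intros n q H | intros n q q' H];
    destruct (inV_emptyV _ H).
Qed.

(** The domain of [g] lies below [j], so index [j] is free and the enlarged set is still a function;
    the maximum of the old bound and the new one serves all its values. *)
Lemma partial_map_extend C k j g m q : bound_system C ->
  partial_map j g -> (forall n p, inV (opair n p) g -> bounds C p k m) -> inV q P ->
  exists g' m', partial_map (S j) g' /\ subV g g' /\
    (exists q', leV r q' q /\ inV (opair (numV j) q') g') /\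
    (forall n p, inV (opair n p) g' -> bounds C p k m').
Proof.
  intros HC [HgM [HgP [Hdom Hfun]]] Hb Hq.
  destruct (bs_dense _ HC q k Hq) as [q' [m1 [Hq' Hm1]]].
  assert (Hq'P : inV q' P) by apply (le_P _ _ Hq').
  exists (adjoin g (opair (numV j) q')), (Nat.max m m1); split; [|split; [|split]].
  - split; [apply M_adjoin; auto using M_opair, M_numV, P_elt_M|]; split; [|split].
    + intros z Hz; apply inV_adjoin in Hz; destruct Hz as [Hz|Hz]; [auto|].
      rewrite Hz; apply opair_prodV; auto using numV_omegaV.
    + intros n p Hn; cbn; apply inV_succV; apply inV_adjoin in Hn; destruct Hn as [Hn|Hn].
      * left; eauto.
      * right; apply opair_inj in Hn; tauto.
    + intros n p p' H H'; apply inV_adjoin in H; apply inV_adjoin in H'.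
      destruct H as [H|H], H' as [H'|H']; [eauto | | |].
      * apply opair_inj in H'; destruct H' as [H' _]; apply Hdom in H.
        rewrite H' in H; destruct (inV_irrefl _ H).
      * apply opair_inj in H; destruct H as [H _]; apply Hdom in H'.
        rewrite H in H'; destruct (inV_irrefl _ H').
      * apply opair_inj in H; apply opair_inj in H'; destruct H as [_ ->], H' as [_ ->]; reflexivity.
  - intros z Hz; apply inV_adjoin; auto.
  - exists q'; split; trivial; apply inV_adjoin; right; reflexivity.
  - intros n p H; apply inV_adjoin in H; destruct H as [H|H].
    + apply (bs_up _ HC p k m); [lia | eauto].
    + apply opair_inj in H; destruct H as [_ H]; unfold bounds; rewrite H.
      apply (bs_up _ HC q' k m1); [lia | trivial].
Qed.

(** Preserving the index [n] lets the conditions below the n-th candidate be followed from step to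
    step. That [m] is common to all indices makes the resulting bound independent of the
    candidate. *)
Definition next_map (C Q : V) (k : nat) (g g' : V) (m : nat) : Prop :=
  (forall n q, inV (opair n q) g -> exists q', leV r q' q /\ inV (opair n q') g') /\
  (exists q q', inV (opair (numV k) q) Q /\ leV r q' q /\ inV (opair (numV k) q') g') /\
  (forall n q, inV (opair n q) g' -> bounds C q k m).

(** The domain of [g] lies below [k], so [k] rounds strengthen all its conditions; the new candidate
    then takes index [k]. *)
Lemma next_map_exists C Q k g : bound_system C ->
  (exists q, inV q P /\ inV (opair (numV k) q) Q) -> partial_map k g ->
  exists g' m, partial_map (S k) g' /\ next_map C Q k g g' m.
Proof.
  intros HC [q [HqP HqQ]] [HgM [HgP [Hdom Hfun]]].
  assert (K : forall j, exists g' m, partial_map j g' /\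
    (forall i p, i < j -> inV (opair (numV i) p) g ->
       exists p', leV r p' p /\ inV (opair (numV i) p') g') /\
    (forall n p, inV (opair n p) g' -> bounds C p k m)).
  { induction j as [|j [g' [m [Hg' [H1 H2]]]]].
    - exists emptyV, 0; split; [apply partial_map_empty|]; split; [lia|].
      intros n p H; destruct (inV_emptyV _ H).
    - destruct (classic (exists p, inV (opair (numV j) p) g)) as [[p Hp]|Hn].
      + assert (HpP : inV p P) by (apply HgP, opair_prodV in Hp; tauto).
        destruct (partial_map_extend C k j g' m p HC Hg' H2 HpP)
          as [g2 [m2 [Hg2 [Hsub [[p' [Hp' Hp'g]] Hb]]]]].
        exists g2, m2; split; [|split]; trivial; intros i s Hi Hs.
        destruct (Nat.eq_dec i j) as [->|].
        * exists p'; rewrite (Hfun _ _ _ Hs Hp); auto.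
        * destruct (H1 i s) as [s' [Hs' Hs'g]]; [lia | trivial |]; eauto.
      + exists g', m; split; [|split]; trivial.
        * destruct Hg' as [K1 [K2 [K3 K4]]]; split; [trivial | split; [trivial | split; trivial]].
          intros n p Hp; cbn; apply inV_succV; left; eauto.
        * intros i s Hi Hs; apply H1; trivial.
          destruct (Nat.eq_dec i j) as [->|]; [exfalso; eauto | lia]. }
  destruct (K k) as [g' [m [Hg' [H1 H2]]]].
  destruct (partial_map_extend C k k g' m q HC Hg' H2 HqP)
    as [g2 [m2 [Hg2 [Hsub [[q' [Hq' Hq'g]] Hb]]]]].
  exists g2, m2; split; trivial; split; [|split; trivial].
  - intros n p Hp; pose proof (Hdom _ _ Hp) as Hn; apply inV_numV in Hn.
    destruct Hn as [i [Hi En]]; rewrite En in Hp.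
    destruct (H1 i p Hi Hp) as [p' [Hp' Hp'g]]; exists p'; split; trivial.
    apply Hsub; rewrite En; exact Hp'g.
  - exists q, q'; auto.
Qed.

(* Dependent choice inside M, applied to triples (k, g, m): at stage k the finitely many
   conditions in the range of g are all strengthened to bound the k-th values by a common m. *)
Lemma fusion_sequence C Q : bound_system C -> inV Q M ->
  (forall k, exists q, inV q P /\ inV (opair (numV k) q) Q) ->
  exists k0 (g : nat -> V) (m : nat -> nat),
    (forall i, next_map C Q (k0 + i) (g i) (g (S i)) (m (S i))) /\
    exists f, inV f M /\ forall n b, inV (opair n b) f <->
      exists i, eqV n (numV i) /\ eqV b (opair (numV (k0 + i)) (opair (g i) (numV (m i)))).
Proof.
  intros HC HQ HQk; pose proof r_M as HrM; pose proof (bs_M _ HC) as HCM.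
  pose proof M_omegaV as HoM.
  destruct (M_powerset (prodV omegaV P)) as [w [Hw Kw]]; [auto using M_prodV, P_M|].
  destruct (M_separation phi_base [] (prodV omegaV (prodV w omegaV))) as [A [HA KA]];
    [cbn; tauto | auto | auto using M_prodV |].
  assert (SA : forall a, inV a M -> sat M (upd (params []) 0 a) phi_base <->
    exists k, inV k M /\ exists g, inV g M /\ exists m, inV m M /\ eqV a (opair k (opair g m)) /\
      (forall n, inV n M -> forall q, inV q M -> inV (opair n q) g -> inV n k) /\
      (forall n, inV n M -> forall q, inV q M -> forall q', inV q' M ->
         inV (opair n q) g -> inV (opair n q') g -> eqV q q')) by (intros a Ha; sem).
  assert (KA' : forall a, inV a A <-> exists k g m,
    eqV a (opair (numV k) (opair g (numV m))) /\ partial_map k g).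
  { intros a; rewrite KA; split.
    - intros [Ha HS]; apply SA in HS; [|eapply Mtrans; [exact Ha | auto using M_prodV]].
      destruct HS as [k [Hk [g [Hg [m [Hm [E [H1 H2]]]]]]]].
      rewrite E, !opair_prodV in Ha; destruct Ha as [[k' Hk'] [Hgw [m' Hm']]].
      cbn in Hk', Hm'; apply Kw in Hgw.
      exists k', g, m'; split; [now rewrite <- Hk', <- Hm'|].
      split; [trivial | split; [apply Hgw | split]].
      + intros n q Hnq; rewrite <- Hk'; destruct (pair_in_M _ _ _ Hnq Hg); eauto.
      + intros n q q' Hnq Hnq'; destruct (pair_in_M _ _ _ Hnq Hg), (pair_in_M _ _ _ Hnq' Hg); eauto.
    - intros [k [g [m [E [Hg [HgP [Hdom Hfun]]]]]]].
      assert (HaM : inV a M) by (rewrite E; auto using M_opair, M_numV).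
      split; [rewrite E, !opair_prodV, Kw; auto using numV_omegaV|].
      apply SA; trivial; exists (numV k); split; [apply M_numV|].
      exists g; split; trivial; exists (numV m); split; [apply M_numV|]; split; [trivial | split; eauto]. }
  destruct (M_separation phi_next [r; C; Q] (prodV A A)) as [R [HR KR]];
    [cbn; tauto | auto | auto using M_prodV |].
  assert (SR : forall x, inV x M -> sat M (upd (params [r; C; Q]) 0 x) phi_next <->
    exists a, inV a M /\ exists b, inV b M /\ exists k, inV k M /\ exists g, inV g M /\
    exists m, inV m M /\ exists k', inV k' M /\ exists g', inV g' M /\ exists m', inV m' M /\
      eqV x (opair a b) /\ eqV a (opair k (opair g m)) /\ eqV b (opair k' (opair g' m')) /\
      eqV k' (succV k) /\
      (forall n, inV n M -> forall q, inV q M -> inV (opair n q) g ->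
         exists q', inV q' M /\ inV (opair q' q) r /\ inV (opair n q') g') /\
      (exists q, inV q M /\ exists q', inV q' M /\ inV (opair k q) Q /\ inV (opair q' q) r /\
         inV (opair k q') g') /\
      (forall n, inV n M -> forall q, inV q M -> inV (opair n q) g' ->
         inV (opair q (opair k m')) C)) by (intros x Hx; sem).
  assert (KR1 : forall k g m b, inV (opair (opair (numV k) (opair g (numV m))) b) R ->
    exists g' m', eqV b (opair (numV (S k)) (opair g' (numV m'))) /\ next_map C Q k g g' m').
  { intros k g m b H; pose proof (Mtrans _ _ H HR) as HM.
    apply KR in H; destruct H as [Hab H]; apply opair_prodV in Hab; destruct Hab as [_ HbA].
    apply SR in H; trivial.
    destruct H as [a0 [_ [b0 [_ [k0 [_ [g0 [Hg0 [m0 [_ [k' [_ [g' [Hg' [m' [_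
      [E0 [Ea [Eb [Ek [H1 [H2 H3]]]]]]]]]]]]]]]]]]]]]].
    apply opair_inj in E0; destruct E0 as [E1 E2]; rewrite <- E1 in Ea; rewrite <- E2 in Eb.
    apply opair_inj in Ea; destruct Ea as [Ek0 Ea]; apply opair_inj in Ea; destruct Ea as [Eg0 _].
    (* The relation alone leaves [m'] an arbitrary set; that it is a numeral comes from membership
       of [b] in [A]. *)
    apply KA' in HbA; destruct HbA as [k2 [g2 [m2 [Eb' _]]]]; rewrite Eb in Eb'.
    apply opair_inj in Eb'; destruct Eb' as [Ek2 Eb']; apply opair_inj in Eb'.
    destruct Eb' as [_ Em2].
    exists g', m2; split; [rewrite Eb, Ek, <- Ek0, Em2; reflexivity|].
    split; [|split].
    - intros n q Hn; rewrite Eg0 in Hn; destruct (pair_in_M _ _ _ Hn Hg0) as [HnM HqM].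
      destruct (H1 n HnM q HqM Hn) as [q' [_ Hq']]; eauto.
    - destruct H2 as [q [_ [q' [_ H2]]]]; exists q, q'; rewrite Ek0; exact H2.
    - intros n q Hn; destruct (pair_in_M _ _ _ Hn Hg') as [HnM HqM].
      unfold bounds; rewrite Ek0, <- Em2; eauto. }
  destruct (M_dependent_choice A R HA HR) as [a [HaA [HaR [f [Hf Kf]]]]].
  - exists (opair (numV 0) (opair emptyV (numV 0))); apply KA'; exists 0, emptyV, 0.
    split; [reflexivity | apply partial_map_empty].
  - intros a Ha; pose proof Ha as Ha'; apply KA' in Ha; destruct Ha as [k [g [m [Ea Hg]]]].
    destruct (next_map_exists C Q k g HC (HQk k) Hg) as [g' [m' [Hg' [H1 [H2 H3]]]]].
    assert (HgM : inV g M) by apply Hg. assert (Hg'M : inV g' M) by apply Hg'.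
    set (b := opair (numV (S k)) (opair g' (numV m'))).
    assert (HbA : inV b A) by (apply KA'; exists (S k), g', m'; split; [reflexivity | trivial]).
    exists b; split; trivial; apply KR; split; [apply opair_prodV; auto|].
    assert (HaM : inV a M) by eauto. assert (HbM : inV b M) by eauto.
    apply SR; [auto using M_opair|].
    exists a; split; trivial; exists b; split; trivial; exists (numV k); split; [apply M_numV|].
    exists g; split; trivial; exists (numV m); split; [apply M_numV|].
    exists (numV (S k)); split; [apply M_numV|]; exists g'; split; trivial.
    exists (numV m'); split; [apply M_numV|].
    split; [reflexivity | split; [trivial | split; [reflexivity | split; [reflexivity|]]]].
    split; [|split].
    + intros n _ q _ Hn; destruct (H1 n q Hn) as [q' [Hq' Hn']].
      exists q'; split; [apply (le_M _ _ Hq')|auto].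
    + destruct H2 as [q [q' [H2 [Hq' H4]]]]; destruct (le_M _ _ Hq') as [K1 K2].
      exists q; split; trivial; exists q'; auto.
    + intros n _ q _ Hn; apply (H3 n q Hn).
  (* Dependent choice does not prescribe its first element, so the sequence starts at some unknown
     stage [k0]. *)
  - pose proof (HaA 0) as Ha0; apply KA' in Ha0; destruct Ha0 as [k0 [g0 [m0 [E0 _]]]].
    assert (K : forall i, exists gm : V * nat,
      eqV (a i) (opair (numV (k0 + i)) (opair (fst gm) (numV (snd gm))))).
    { induction i as [|i [gm E]].
      - exists (g0, m0); cbn [fst snd]; rewrite Nat.add_0_r; exact E0.
      - pose proof (HaR i) as H; rewrite E in H; apply KR1 in H.
        destruct H as [g' [m' [H _]]]; exists (g', m'); rewrite Nat.add_succ_r; exact H. }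
    set (gm := fun i => proj1_sig (constructive_indefinite_description _ (K i))).
    assert (Ka : forall i, eqV (a i) (opair (numV (k0 + i)) (opair (fst (gm i)) (numV (snd (gm i))))))
      by (intros i; exact (proj2_sig (constructive_indefinite_description _ (K i)))).
    exists k0, (fun i => fst (gm i)), (fun i => snd (gm i)); split.
    + intros i; pose proof (HaR i) as H; rewrite (Ka i) in H; apply KR1 in H.
      destruct H as [g' [m' [H1 [K1 [K2 K3]]]]]; rewrite (Ka (S i)) in H1.
      apply opair_inj in H1; destruct H1 as [_ H1]; apply opair_inj in H1.
      destruct H1 as [Eg Em]; apply numV_inj in Em; split; [|split].
      * intros n q Hn; destruct (K1 n q Hn) as [q' Hq']; exists q'; rewrite Eg; exact Hq'.
      * destruct K2 as [q [q' Hq']]; exists q, q'; rewrite Eg; exact Hq'.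
      * intros n q Hn; rewrite Eg in Hn; rewrite Em; eauto.
    + exists f; split; trivial; intros n b; rewrite Kf.
      split; intros [i [H1 H2]]; exists i; split; trivial; rewrite H2, (Ka i); reflexivity.
Qed.

(** The part of a promise that does not mention [d]; the inequality z < d is always carried
    separately. *)
Definition keeps (C p : V) (z : nat -> nat) (N : nat) : Prop :=
  inV p P /\ inV (realV z) M /\
  forall K, exists q, leV r q p /\ forall j, N <= j < K -> bounds C q j (z j).

(** Column [n] of [Q] supplies the n-th candidate. Following its index through the fusion gives a
    descending sequence whose members bound one more value each, by numbers that do not depend on
    [n]. *)
Lemma common_bound C Q : bound_system C -> inV Q M ->
  (forall k, exists q, inV q P /\ inV (opair (numV k) q) Q) ->
  exists h k0, inV (realV h) M /\ forall n, k0 <= n ->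
    exists q, inV (opair (numV n) q) Q /\ keeps C q h n.
Proof.
  intros HC HQ HQk; destruct (fusion_sequence C Q HC HQ HQk) as [k0 [g [m [Hnext [f [Hf Kf]]]]]].
  (* The step from stage k0 + i records its bound in [m (S i)], hence the successor. Below [k0] the
     value 0 is a dummy. *)
  set (h := fun j => if j <? k0 then 0 else m (S (j - k0))).
  assert (Hh : inV (realV h) M).
  { pose proof M_omegaV as HoM; pose proof (M_numV k0) as HkM.
    destruct (M_separation phi_bound [f; numV k0] (prodV omegaV omegaV)) as [c [Hc Kc]];
      [cbn; tauto | auto | auto using M_prodV |].
    assert (Sx : forall x, inV x M -> sat M (upd (params [f; numV k0]) 0 x) phi_bound <->
      exists k, inV k M /\ exists y, inV y M /\ eqV x (opair k y) /\
        ((inV k (numV k0) /\ eqV y emptyV) \/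
         (~ inV k (numV k0) /\ exists i, inV i M /\ exists t, inV t M /\ exists k', inV k' M /\
           exists u, inV u M /\ inV (opair i t) f /\ eqV t (opair k' (opair u y)) /\
             eqV k' (succV k)))) by (intros x Hx; sem).
    assert (E : eqV c (realV h)); [|rewrite <- E; exact Hc].
    apply eqV_ext; intros x; rewrite Kc, inV_realV; split.
    - intros [Hx H]; apply Sx in H; [|eapply Mtrans; [exact Hx | auto using M_prodV]].
      destruct H as [k [_ [y [_ [E H]]]]].
      rewrite E, opair_prodV in Hx; destruct Hx as [Hk Hy].
      apply inV_omegaV in Hk; apply inV_omegaV in Hy; destruct Hk as [k' Hk], Hy as [y' Hy].
      exists k'; rewrite E, Hk; apply opair_eq; [reflexivity|]; unfold h.
      rewrite Hk, inV_numV_numV in H; destruct H as [[Hlt Hy0]|[Hge H]].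
      + destruct (Nat.ltb_spec k' k0); [exact Hy0 | lia].
      + destruct (Nat.ltb_spec k' k0); [lia|].
        destruct H as [i [_ [t [_ [s [_ [u [_ [Hit [Et Es]]]]]]]]]].
        apply Kf in Hit; destruct Hit as [i' [_ Hit]]; rewrite Et in Hit.
        apply opair_inj in Hit; destruct Hit as [E1 Hit]; apply opair_inj in Hit.
        destruct Hit as [_ E2]; rewrite Es, Hk in E1.
        apply (numV_inj (1 + k')) in E1; replace (S (k' - k0)) with i' by lia; exact E2.
    - intros [k E]; split; [rewrite E, opair_prodV; auto using numV_omegaV|].
      apply Sx; [rewrite E; auto using M_opair, M_numV|].
      exists (numV k); split; [apply M_numV|]; exists (numV (h k)); split; [apply M_numV|].
      split; [exact E|]; rewrite inV_numV_numV; unfold h.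
      destruct (Nat.ltb_spec k k0) as [Hk|Hk]; [left; split; [exact Hk | reflexivity] | right].
      split; [lia|].
      assert (Hin : inV (opair (numV (1 + (k - k0)))
        (opair (numV (1 + k)) (opair (g (1 + (k - k0))) (numV (m (1 + (k - k0))))))) f).
      { apply Kf; exists (1 + (k - k0)); split; [reflexivity|].
        replace (k0 + (1 + (k - k0))) with (1 + k) by lia; reflexivity. }
      destruct (pair_in_M _ _ _ Hin Hf) as [HiM HtM].
      destruct (M_opair_inv M Mtrans _ _ HtM) as [Hk1 Hgm].
      destruct (M_opair_inv M Mtrans _ _ Hgm) as [HgM _].
      eexists; split; [exact HiM|]; eexists; split; [exact HtM|].
      eexists; split; [exact Hk1|]; eexists; split; [exact HgM|].
      split; [exact Hin|]; split; reflexivity. }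
  exists h, k0; split; trivial; intros n Hn.
  set (i := n - k0); assert (Ei : k0 + i = n) by (unfold i; lia).
  destruct (Hnext i) as [_ [[q [q1 [Hq [Hq1 Hq1g]]]] _]]; rewrite Ei in *.
  exists q; split; trivial; split; [apply (le_P _ _ Hq1)|]; split; trivial.
  (* After l more steps the condition at index [n] has collected all bounds on [n, n + l], as bounds
     pass to extensions. *)
  assert (K : forall l, exists q', leV r q' q1 /\ inV (opair (numV n) q') (g (S (i + l))) /\
    forall j, n <= j <= n + l -> bounds C q' j (h j)).
  { assert (B : forall l q', inV (opair (numV n) q') (g (S (i + l))) ->
      bounds C q' (n + l) (h (n + l))).
    { intros l q' Hq'; destruct (Hnext (i + l)) as [_ [_ H]]; apply H in Hq'.
      unfold h; destruct (Nat.ltb_spec (n + l) k0); [lia|].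
      replace (n + l - k0) with (i + l) by lia.
      replace (n + l) with (k0 + (i + l)) by lia; exact Hq'. }
    induction l as [|l [q2 [Hq2 [Hq2g Hb]]]].
    - exists q1; split; [apply le_refl, (le_P _ _ Hq1)|].
      rewrite Nat.add_0_r; split; trivial; intros j Hj.
      replace j with (n + 0) by lia; apply B; rewrite Nat.add_0_r; exact Hq1g.
    - destruct (Hnext (S (i + l))) as [H _]; destruct (H _ _ Hq2g) as [q3 [Hq3 Hq3g]].
      rewrite <- (Nat.add_succ_r i l) in Hq3g.
      exists q3; split; [eauto using le_trans|]; split; trivial; intros j Hj.
      destruct (Nat.eq_dec j (n + S l)) as [->|]; [apply B; exact Hq3g|].
      apply (bs_le _ HC q2); trivial; apply Hb; lia. }
  intros L; destruct (K L) as [q' [Hq' [_ Hb]]]; exists q'; split; [eauto using le_trans|].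
  intros j Hj; apply Hb; lia.
Qed.

(** The old promise is paid in [C], but only up to N'; from there on the new promise speaks about
    [C']. This is where an additional name can be taken in. *)
Lemma keeps_step d C C' p z N D :
  dominating_over lt_star M d ->
  bound_system C -> bound_system C' -> keeps C p z N -> inV D M -> dense P r D ->
  exists p' z' N', inV p' D /\ leV r p' p /\ N < N' /\ keeps C' p' z' N' /\
    (forall j, N' <= j -> z' j < d j) /\
    (forall j, N <= j < N' -> bounds C p' j (z j)).
Proof.
  intros Hd HC HC' [Hp [Hz Hk]] HD [HDP Hdense]; pose proof r_M as HrM.
  pose proof (bs_M _ HC) as HCM; pose proof M_omegaV as HoM.
  pose proof (P_elt_M p Hp) as HpM; pose proof (M_numV N) as HNM.
  (* Column [k] of [Q] consists of the extensions of [p] in [D] that honour [z] on [N, k). *)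
  destruct (M_separation phi_start [D; p; r; numV N; realV z; C] (prodV omegaV P))
    as [Q [HQ KQ]]; [cbn; tauto | repeat (constructor; trivial) | auto using M_prodV, P_M |].
  assert (Sx : forall x, inV x M ->
    sat M (upd (params [D; p; r; numV N; realV z; C]) 0 x) phi_start <->
    exists k, inV k M /\ exists q, inV q M /\ eqV x (opair k q) /\ inV q D /\ inV (opair q p) r /\
      forall j, inV j M -> inV j k -> ~ inV j (numV N) ->
        exists m, inV m M /\ inV (opair j m) (realV z) /\ inV (opair q (opair j m)) C)
    by (intros x Hx; sem).
  assert (KQ' : forall k q, inV (opair (numV k) q) Q <->
    inV q D /\ leV r q p /\ forall j, N <= j < k -> bounds C q j (z j)).
  { intros k q; rewrite KQ, opair_prodV; split.
    - intros [[_ HqP] H]; apply Sx in H; [|auto using M_opair, M_numV, P_elt_M].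
      destruct H as [k' [_ [q' [_ [E [HqD [Hqp H]]]]]]].
      apply opair_inj in E; destruct E as [E1 E2]; rewrite E2; split; [trivial | split; trivial].
      intros j Hj; destruct (H (numV j) (M_numV j)) as [m [_ [Hm Hb]]].
      + rewrite <- E1; apply inV_numV_numV; lia.
      + rewrite inV_numV_numV; lia.
      + apply inV_realV in Hm; destruct Hm as [i Hm]; apply opair_inj in Hm.
        destruct Hm as [Ej Em]; apply numV_inj in Ej; subst i.
        unfold bounds; rewrite E2, <- Em; exact Hb.
    - intros [HqD [Hqp H]]; assert (HqP : inV q P) by auto.
      split; [auto using numV_omegaV|]; apply Sx; [auto using M_opair, M_numV, P_elt_M|].
      exists (numV k); split; [apply M_numV|]; exists q; split; [auto using P_elt_M|].
      split; [reflexivity|]; split; trivial; split; trivial.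
      intros j _ Hj HjN; apply inV_numV in Hj; destruct Hj as [j' [Hj Ej]].
      rewrite Ej, inV_numV_numV in HjN.
      exists (numV (z j')); split; [apply M_numV|]; rewrite Ej; split.
      + apply opair_numV_realV; reflexivity.
      + apply H; lia. }
  (* Columns are nonempty by the old promise for the window [N, k), followed by density of [D]; the
     fusion itself runs in [C']. *)
  destruct (common_bound C' Q HC' HQ) as [h [k0 [Hh Hn]]].
  - intros k; destruct (Hk k) as [q [Hq Hb]].
    destruct (Hdense q) as [q' [Hq'D Hq']]; [apply (le_P _ _ Hq)|].
    exists q'; split; [auto|]; apply KQ'; split; trivial; split; [eauto using le_trans|].
    intros j Hj; apply (bs_le _ HC q); auto.
  - destruct (Hd h Hh) as [N0 HN0].
    (* Beyond [k0] there are candidates with promise [h], beyond [N0] the function [d] exceeds [h],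
       and [1 + N] makes the windows advance. *)
    destruct (Hn (Nat.max k0 (Nat.max N0 (1 + N)))) as [q [HqQ Hkeep]]; [lia|].
    apply KQ' in HqQ; destruct HqQ as [HqD [Hqp Hb]].
    exists q, h, (Nat.max k0 (Nat.max N0 (1 + N))).
    split; [trivial | split; [trivial | split; [lia | split; [trivial | split]]]].
    + intros j Hj; apply HN0; lia.
    + exact Hb.
Qed.

(** The same fusion without an earlier promise: every condition is a candidate in every column. *)
Lemma keeps_start d : dominating_over lt_star M d ->
  exists C p z N, bound_system C /\ keeps C p z N /\ forall j, N <= j -> z j < d j.
Proof.
  intros Hd; destruct trivial_bound_system as [C HC].
  destruct (common_bound C (prodV omegaV P) HC) as [h [k0 [Hh Hn]]].
  - auto using M_prodV, M_omegaV, P_M.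
  - intros k; destruct Hforc as [[p Hp] _]; exists p; rewrite opair_prodV.
    auto using numV_omegaV.
  - destruct (Hd h Hh) as [N0 HN0].
    destruct (Hn (Nat.max k0 N0)) as [q [_ Hkeep]]; [lia|].
    exists C, q, h, (Nat.max k0 N0); split; [trivial | split; trivial].
    intros j Hj; apply HN0; lia.
Qed.

(** * The descending sequence and its generic filter *)

Record stage := Stage { st_p : V; st_C : V; st_z : nat -> nat; st_N : nat }.

(** Each [e n] is treated both as a dense set to be met and as a name to be handled. If it is not a
    dense set in [M], the dense set [P] takes its place; if it is not in [M], the bound system stays
    as it is. *)
Lemma stages_exist (d : nat -> nat) (e : nat -> V) : dominating_over lt_star M d ->
  exists s : nat -> stage, forall n,
    let a := s n in let b := s (S n) in
    inV (st_p a) P /\ (forall j, st_N a <= j -> st_z a j < d j) /\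
    leV r (st_p b) (st_p a) /\ st_N a < st_N b /\
    (forall j, st_N a <= j < st_N b -> bounds (st_C a) (st_p b) j (st_z a j)) /\
    (forall q k m, bounds (st_C b) q k m -> bounds (st_C a) q k m) /\
    (inV (e n) M -> dense P r (e n) -> inV (st_p b) (e n)) /\
    (inV (e n) M -> handles (st_C b) (e n)).
Proof.
  intros Hd.
  set (ok := fun a => bound_system (st_C a) /\ keeps (st_C a) (st_p a) (st_z a) (st_N a) /\
    forall j, st_N a <= j -> st_z a j < d j).
  assert (Hstep : forall n (a : sig ok), exists b : sig ok,
    let a := proj1_sig a in let b := proj1_sig b in
    leV r (st_p b) (st_p a) /\ st_N a < st_N b /\
    (forall j, st_N a <= j < st_N b -> bounds (st_C a) (st_p b) j (st_z a j)) /\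
    (forall q k m, bounds (st_C b) q k m -> bounds (st_C a) q k m) /\
    (inV (e n) M -> dense P r (e n) -> inV (st_p b) (e n)) /\
    (inV (e n) M -> handles (st_C b) (e n))).
  { intros n [[p C z N] [HC [Hk Hz]]]; cbn in HC, Hk, Hz; cbn [proj1_sig st_p st_C st_z st_N].
    assert (HC' : exists C', bound_system C' /\ (inV (e n) M -> handles C' (e n)) /\
      forall q k m, bounds C' q k m -> bounds C q k m).
    { destruct (classic (inV (e n) M)) as [H|H].
      - destruct (handle_name C (e n) HC H) as [C' [H1 [H2 H3]]]; eauto.
      - exists C; split; [trivial | split; [tauto | trivial]]. }
    destruct HC' as [C' [HC' [Hh Hsub]]].
    assert (HD : exists D, inV D M /\ dense P r D /\
      (inV (e n) M -> dense P r (e n) -> eqV D (e n))).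
    { destruct (classic (inV (e n) M /\ dense P r (e n))) as [[H1 H2]|H].
      - exists (e n); split; [trivial | split; [trivial | reflexivity]].
      - exists P; split; [exact P_M | split; [|tauto]].
        split; [intros q; trivial|]; intros q Hq; exists q; auto using le_refl. }
    destruct HD as [D [HDM [HDd HDe]]].
    destruct (keeps_step d C C' p z N D Hd HC HC' Hk HDM HDd)
      as [p' [z' [N' [H1 [H2 [H3 [H4 [H5 H6]]]]]]]].
    assert (Hok : ok (Stage p' C' z' N')) by (split; [|split]; trivial).
    exists (exist _ _ Hok); cbn [proj1_sig st_p st_C st_z st_N].
    split; [trivial | split; [trivial | split; [trivial | split; [trivial | split; trivial]]]].
    intros He1 He2; rewrite <- (HDe He1 He2); exact H1. }
  destruct (keeps_start d Hd) as [C [p [z [N H0]]]].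
  set (next := fun n a => proj1_sig (constructive_indefinite_description _ (Hstep n a))).
  set (s := fix s n := match n with 0 => exist ok (Stage p C z N) H0 | S n => next n (s n) end).
  exists (fun n => proj1_sig (s n)); intros n; cbn zeta.
  split; [apply (proj2_sig (s n))|]; split; [apply (proj2_sig (s n))|].
  exact (proj2_sig (constructive_indefinite_description _ (Hstep n (s n)))).
Qed.

Lemma universally_dominating (d : nat -> nat) (e : nat -> V) :
  (forall x, inV x M -> exists n, eqV x (e n)) -> dominating_over lt_star M d ->
  exists G, generic M P r G /\ dominating_over lt_star (generic_extension M P G) d.
Proof.
  intros He Hd; destruct (stages_exist d e Hd) as [s Hs].
  set (p := fun n => st_p (s n)).
  assert (Hp : forall n, inV (p n) P) by (intros n; apply Hs).
  assert (Hle : forall n m, n <= m -> leV r (p m) (p n)).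
  { intros n m H; induction H as [|m H IH]; [apply le_refl, Hp|].
    apply (le_trans _ (p m)); [apply Hs | exact IH]. }
  set (G := @sup {a : idx P | exists n, leV r (p n) (elt a)} (fun a => elt (proj1_sig a))).
  assert (KG : forall x, inV x G <-> exists n, leV r (p n) x).
  { intros x; split.
    - intros [[a [n Hn]] E]; cbn in E; exists n; rewrite E; exact Hn.
    - intros [n Hn]; destruct (le_P _ _ Hn) as [_ [a Ha]].
      assert (Ha' : exists n, leV r (p n) (elt a)) by (exists n; rewrite <- Ha; exact Hn).
      exists (exist _ a Ha'); exact Ha. }
  assert (HpG : forall n, inV (p n) G) by (intros n; apply KG; exists n; apply le_refl, Hp).
  assert (HG : generic M P r G).
  { split; [split; [|split; [|split]]|].
    - intros x Hx; apply KG in Hx; destruct Hx as [n Hn]; apply (le_P _ _ Hn).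
    - exists (p 0); apply HpG.
    - intros x y Hx _ Hxy; apply KG in Hx; destruct Hx as [n Hn].
      apply KG; exists n; eauto using le_trans.
    - intros x y Hx Hy; apply KG in Hx; apply KG in Hy; destruct Hx as [n Hn], Hy as [m Hm].
      exists (p (Nat.max n m)); split; [apply HpG|].
      split; [apply (le_trans _ (p n)) | apply (le_trans _ (p m))]; trivial; apply Hle; lia.
    - intros D HD HDd; destruct (He D HD) as [n En].
      exists (p (S n)); split; [apply HpG|]; rewrite En; apply Hs.
      + rewrite <- En; exact HD.
      + destruct HDd as [H1 H2]; split.
        * intros x Hx; apply H1; rewrite En; exact Hx.
        * intros q Hq; destruct (H2 q Hq) as [q' Hq']; exists q'; rewrite <- En; exact Hq'. }
  exists G; split; trivial; intros x [[a Ha] Hx]; cbn in Hx.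
  assert (HaM : inV (elt a) M) by apply inV_elt.
  destruct (He _ HaM) as [i Ei].
  assert (Hhan : handles (st_C (s (S i))) (e i)) by (apply Hs; rewrite <- Ei; exact HaM).
  assert (Hsub : forall n m, n <= m -> forall q k b,
    bounds (st_C (s m)) q k b -> bounds (st_C (s n)) q k b).
  { intros n m H; induction H as [|m H IH]; [trivial|]; intros q k b Hb; apply IH.
    apply (Hs m), Hb. }
  exists (st_N (s (S i))); intros k Hk.
  (* The endpoints increase strictly, so the windows from stage [S i] on cover everything beyond its
     endpoint. *)
  assert (Hl : exists l, S i <= l /\ st_N (s l) <= k < st_N (s (S l))).
  { assert (Hgrow : forall n, n <= st_N (s n)).
    { induction n as [|n IH]; [lia|]; pose proof (Hs n) as H; cbn zeta in H; lia. }
    assert (K : forall n, k < st_N (s (S i + n)) ->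
      exists l, S i <= l /\ st_N (s l) <= k < st_N (s (S l))).
    { induction n as [|n IH]; intros H; [rewrite Nat.add_0_r in H; lia|].
      destruct (le_lt_dec (st_N (s (S i + n))) k) as [L|L]; [|auto].
      exists (S i + n); rewrite Nat.add_succ_r in H; split; [lia | auto]. }
    apply (K (1 + k)); pose proof (Hgrow (S i + (1 + k))); lia. }
  destruct Hl as [l [Hil Hkl]].
  pose proof (Hs l) as H; cbn zeta in H; destruct H as [_ [Hzd [_ [_ [Hb _]]]]].
  (* In the window of stage [l] the condition p(l+1) bounds the value by the promise of that stage.
     The bound counts for the i-th name since later bound systems are contained in the one that
     handles it. *)
  apply Nat.lt_trans with (st_z (s l) k); [|apply Hzd; lia].
  apply (Hhan G x HG) with (q := p (S l)).
  - rewrite <- Ei; exact Hx.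
  - apply HpG.
  - apply (Hsub (S i) l Hil), Hb, Hkl.
Qed.

End Model.

(** Models of a larger fragment are models of [fragment], so the choice of that one list covers
    every [T] that includes it. *)
Theorem theorem6p14 :
  exists T0 : list form, finite_fragment T0 /\
  forall T : list form, finite_fragment T -> incl T0 T ->
  total_universality T lt_star.
Proof.
  exists fragment; split; [exact fragment_finite|].
  intros T _ HT M [Mne [Mtrans Msat]] [e He] d Hd P r HPr Hforc.
  apply (universally_dominating M Mne Mtrans (fun A HA => Msat A (HT A HA)) P r HPr Hforc d e);
    trivial.
Qed.
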